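(* Let $h\ge0$, $\ell\ge2$, let $b_1,\ldots,b_h,a_1,\ldots,a_\ell$ be positive integers, let $\beta=[0;b_1,\ldots,b_h,\overline{a_1,\ldots,a_\ell}]$ be a quadratic irrational with period length $\ell$, and let $a_k=\max_{1\le j\le\ell}a_j$. Then $$\liminf_{N\to\infty}P_N(\beta)=0\qquad\text{and}\qquad\limsup_{N\to\infty}\frac{P_N(\beta)}{N}=\infty$$ whenever $a_k\ge23$.
   Context: The Sudler product is $P_N(\beta)=\prod_{r=1}^N|2\sin\pi r\beta|$. An overline denotes the repeated block of a periodic continued fraction. *)

(* Defs.v *)
(* Stdlib reals with Coquelicot. *)
From Stdlib Require Import Reals Lia Lra PeanoNat.
From Coquelicot Require Import Coquelicot.

Open Scope R_scope.

Fixpoint sudler (beta : R) (N : nat) : R :=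
  match N with
  | O => 1
  | S n => sudler beta n * Rabs (2 * sin (PI * INR (S n) * beta))
  end.

(* [convergent_from c i n] is [0; c_i, ..., c_{i+n-1}]. *)
Fixpoint convergent_from (c : nat -> nat) (i n : nat) : R :=
  match n with
  | O => 0
  | S m => / (INR (c i) + convergent_from c (S i) m)
  end.

(* beta = [0; c_1, c_2, ...]; the value [c 0] is not used. *)
Definition is_cfrac (c : nat -> nat) (beta : R) : Prop :=
  is_lim_seq (fun n => convergent_from c 1 n) beta.

(* The sequence b_1, ..., b_h, a_1, ..., a_l, a_1, ..., a_l, ..., indexed from 1;
   only b_1, ..., b_h and a_1, ..., a_l are used when 0 < l. *)
Definition ev_periodic (h l : nat) (b a : nat -> nat) (n : nat) : nat :=
  if (n <=? h)%nat then b n else a (S ((n - h - 1) mod l)).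

(* Main.v *)
Require Import Defs.
From Stdlib Require Import Reals Lia Lra PeanoNat ZArith List Permutation.
From Coquelicot Require Import Coquelicot.

Open Scope R_scope.

(* If [q beta] is close to an integer, then [P_(q + N)(beta)] is close to
   [P_q(beta) P_N(beta)] for fixed [N].  Hence it suffices for the lower limit to
   find arbitrarily large such [q] with [P_q(beta) <= 24/25], and for the upper
   limit, by the reflection [r -> q - r], to have moreover
   [P_(q - 1)(beta) >= kappa q] with a fixed [kappa > 0].

   The [q] are the convergent denominators [q_n] with [c_(n+1) = A], the maximal
   partial quotient.  Put [E = |q_n beta - p_n| <= 1 / (A q_n)] and
   [phi j = j q_(n-1) mod q_n].  Then [P_(q - 1)(beta)] is the product over [j < q]
   of [2 sin (pi (j - E phi j) / q)].  For [E = 0] the product is [q]; since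
   [ln sin] is concave, it is in general at most [q exp V], where
   [V = - (pi E / q) sum_j (phi j) cot (pi j / q)], and it turns out to be at least
   [q exp V / 2].  Splitting intervals greedily into blocks whose lengths
   [Q_0, Q_1, ...] are the convergent denominators of
   [q_(n-1) / q_n = [0; c_n, ..., c_1]] bounds the partial sums of
   [2 phi j - q], and summation by parts gives, with the harmonic numbers [H],
   [|V| <= 2 E q sum_i H(c_(n-i)) / Q_i <= 7 H(A) / A + o(1) <= 6/5],
   whereas [P_q(beta) <= 2 pi E q exp V] and [(2 pi / 23) exp (6/5) < 24/25]. *)

(** * Finite sums and products *)

(** A single fold over the indices 1 to [n], so that invariance under permutations is proved once
    for sums and products. *)
Fixpoint big (op : R -> R -> R) (e : R) (f : nat -> R) (n : nat) : R :=
  match n with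
  | O => e
  | S m => op (big op e f m) (f (S m))
  end.

Notation sum1 := (big Rplus 0).
Notation prod1 := (big Rmult 1).

Lemma sudler_prod1 (beta : R) (N : nat) :
  sudler beta N = prod1 (fun r => Rabs (2 * sin (PI * INR r * beta))) N.
Proof. induction N as [|N IH]; [easy|]. cbn [sudler big]. now rewrite IH. Qed.

Lemma big_ext (op : R -> R -> R) (e : R) (f g : nat -> R) (n : nat) :
  (forall j, (1 <= j <= n)%nat -> f j = g j) -> big op e f n = big op e g n.
Proof.
  intros H; induction n as [|n IH]; [easy|]. cbn.
  rewrite IH, H by (intros; try apply H; lia). easy.
Qed.

Fixpoint down (n : nat) : list nat :=
  match n with
  | O => nil
  | S m => S m :: down m
  end.

Lemma in_down (n j : nat) : In j (down n) <-> (1 <= j <= n)%nat.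
Proof. induction n as [|n IH]; cbn; [lia|]. rewrite IH. lia. Qed.

Lemma NoDup_down (n : nat) : NoDup (down n).
Proof.
  induction n as [|n IH]; cbn; constructor; auto.
  rewrite in_down. lia.
Qed.

Lemma length_down (n : nat) : length (down n) = n.
Proof. induction n; cbn; auto. Qed.

(** An injective self-map of a finite set permutes it, and right-commutativity of [op] makes the
    fold blind to the order of its list. *)
Lemma big_reindex (op : R -> R -> R) (e : R) (phi : nat -> nat) (f : nat -> R)
  (n : nat) :
  (forall x y z, op (op x y) z = op (op x z) y) ->
  (forall j, (1 <= j <= n)%nat -> (1 <= phi j <= n)%nat) ->
  (forall i j, (1 <= i <= n)%nat -> (1 <= j <= n)%nat -> phi i = phi j -> i = j) ->
  big op e (fun j => f (phi j)) n = big op e f n.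
Proof.
  intros Hop Hran Hinj.
  assert (Hbig : forall g m,
    big op e g m = fold_right (fun j x => op x (g j)) e (down m)).
  { intros g m; induction m as [|m IH]; cbn; [easy|]. now rewrite IH. }
  assert (Hmap : forall l, fold_right (fun j x => op x (f (phi j))) e l
    = fold_right (fun j x => op x (f j)) e (map phi l)).
  { induction l as [|a l IH]; cbn; [easy|]. now rewrite IH. }
  assert (Hperm : forall l l', Permutation l l' ->
    fold_right (fun j x => op x (f j)) e l = fold_right (fun j x => op x (f j)) e l').
  { induction 1; cbn; auto; congruence. }
  rewrite !Hbig, Hmap. apply Hperm, NoDup_Permutation_bis.
  - apply NoDup_map_NoDup_ForallPairs; [|apply NoDup_down].
    intros i j Hi Hj. apply Hinj; now apply in_down.
  - now rewrite length_map, !length_down.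
  - intros i Hi. apply in_map_iff in Hi as [j [<- Hj]].
    apply in_down, Hran. now apply in_down.
Qed.

Lemma sum1_reindex (phi : nat -> nat) (f : nat -> R) (n : nat) :
  (forall j, (1 <= j <= n)%nat -> (1 <= phi j <= n)%nat) ->
  (forall i j, (1 <= i <= n)%nat -> (1 <= j <= n)%nat -> phi i = phi j -> i = j) ->
  sum1 (fun j => f (phi j)) n = sum1 f n.
Proof. apply big_reindex. intros; ring. Qed.

Lemma prod1_reindex (phi : nat -> nat) (f : nat -> R) (n : nat) :
  (forall j, (1 <= j <= n)%nat -> (1 <= phi j <= n)%nat) ->
  (forall i j, (1 <= i <= n)%nat -> (1 <= j <= n)%nat -> phi i = phi j -> i = j) ->
  prod1 (fun j => f (phi j)) n = prod1 f n.
Proof. apply big_reindex. intros; ring. Qed.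

Lemma sum1_plus (f g : nat -> R) (n : nat) :
  sum1 (fun j => f j + g j) n = sum1 f n + sum1 g n.
Proof. induction n as [|n IH]; cbn; [|rewrite IH]; ring. Qed.

Lemma sum1_scal (c : R) (f : nat -> R) (n : nat) :
  sum1 (fun j => c * f j) n = c * sum1 f n.
Proof. induction n as [|n IH]; cbn; [|rewrite IH]; ring. Qed.

Lemma sum1_const (c : R) (n : nat) : sum1 (fun _ => c) n = c * INR n.
Proof. induction n as [|n IH]; [cbn; ring|]. rewrite S_INR. cbn [big]. rewrite IH. ring. Qed.

Lemma sum1_id (n : nat) : 2 * sum1 INR n = INR n * (INR n + 1).
Proof.
  induction n as [|n IH]; [cbn; ring|]. rewrite S_INR. cbn [big]. rewrite S_INR.
  lra.
Qed.

Lemma sum1_le (f g : nat -> R) (n : nat) :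
  (forall j, (1 <= j <= n)%nat -> f j <= g j) -> sum1 f n <= sum1 g n.
Proof.
  intros H; induction n as [|n IH]; cbn; [lra|].
  apply Rplus_le_compat; [apply IH; intros|]; apply H; lia.
Qed.

Lemma sum1_app (f : nat -> R) (m n : nat) :
  sum1 f (m + n) = sum1 f m + sum1 (fun j => f (m + j)%nat) n.
Proof.
  induction n as [|n IH]; [rewrite Nat.add_0_r; cbn; ring|].
  rewrite Nat.add_succ_r. cbn [big]. rewrite IH, <- Nat.add_succ_r. ring.
Qed.

Lemma sum1_exchange (f : nat -> nat -> R) (m n : nat) :
  sum1 (fun i => sum1 (f i) n) m = sum1 (fun j => sum1 (fun i => f i j) m) n.
Proof.
  induction m as [|m IH]; cbn.
  - now rewrite sum1_const, Rmult_0_l.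
  - now rewrite IH, sum1_plus.
Qed.

Lemma prod1_mult (f g : nat -> R) (n : nat) :
  prod1 (fun j => f j * g j) n = prod1 f n * prod1 g n.
Proof. induction n as [|n IH]; cbn; [|rewrite IH]; ring. Qed.

Lemma prod1_app (f : nat -> R) (m n : nat) :
  prod1 f (m + n) = prod1 f m * prod1 (fun j => f (m + j)%nat) n.
Proof.
  induction n as [|n IH]; [rewrite Nat.add_0_r; cbn; ring|].
  rewrite Nat.add_succ_r. cbn [big]. rewrite IH, <- Nat.add_succ_r. ring.
Qed.

Lemma prod1_ge_0 (f : nat -> R) (n : nat) :
  (forall j, (1 <= j <= n)%nat -> 0 <= f j) -> 0 <= prod1 f n.
Proof.
  intros H; induction n as [|n IH]; cbn; [lra|].
  apply Rmult_le_pos; [apply IH; intros|]; apply H; lia.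
Qed.

Lemma prod1_le (f g : nat -> R) (n : nat) :
  (forall j, (1 <= j <= n)%nat -> 0 <= f j <= g j) -> prod1 f n <= prod1 g n.
Proof.
  intros H; induction n as [|n IH]; cbn; [lra|].
  apply Rmult_le_compat; [|apply H; lia|apply IH; intros; apply H; lia|apply H; lia].
  apply prod1_ge_0. intros; apply H; lia.
Qed.

Lemma prod1_exp (f : nat -> R) (n : nat) :
  prod1 (fun j => exp (f j)) n = exp (sum1 f n).
Proof. induction n as [|n IH]; cbn; [now rewrite exp_0|]. now rewrite exp_plus, IH. Qed.

Lemma prod1_one_minus (f : nat -> R) (n : nat) :
  (forall j, (1 <= j <= n)%nat -> 0 <= f j <= 1) ->
  1 - sum1 f n <= prod1 (fun j => 1 - f j) n.
Proof.
  intros H.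
  (* The upper bound 1 strengthens the induction: the new factor subtracts [f (S n)] times the
     product so far. *)
  cut (1 - sum1 f n <= prod1 (fun j => 1 - f j) n <= 1); [tauto|].
  induction n as [|n IH]; cbn; [lra|].
  assert (Hn := H (S n) ltac:(lia)).
  assert (Hp : 0 <= prod1 (fun j => 1 - f j) n).
  { apply prod1_ge_0. intros j Hj. specialize (H j ltac:(lia)). lra. }
  destruct IH as [IH1 IH2]; [intros; apply H; lia|].
  split; nra.
Qed.

(* Abel summation; inductively, the sum dominates [w n] times the last partial
   sum of [d]. *)
Lemma abel_nonneg (d w : nat -> R) (n : nat) :
  (forall j, (1 <= j <= n)%nat -> 0 <= w j) ->
  (forall j, (1 <= j < n)%nat -> w (S j) <= w j) ->
  (forall N, (N <= n)%nat -> 0 <= sum1 d N) ->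
  0 <= sum1 (fun j => d j * w j) n.
Proof.
  intros Hw Hdec Hd.
  destruct n as [|n]; [cbn; lra|].
  cut (w (S n) * sum1 d (S n) <= sum1 (fun j => d j * w j) (S n)).
  { intros H. eapply Rle_trans; [|exact H].
    apply Rmult_le_pos; [apply Hw|apply Hd]; lia. }
  induction n as [|n IH]; [cbn; lra|].
  cbn [big] in *.
  specialize (IH ltac:(intros; apply Hw; lia) ltac:(intros; apply Hdec; lia)
    ltac:(intros; apply Hd; lia)).
  assert (H1 := Hdec (S n) ltac:(lia)).
  assert (H2 := Hd (S n) ltac:(lia)). cbn [big] in H2.
  nra.
Qed.

(** * Sine products and trigonometric inequalities *)

(* [f] is a polynomial function of degree at most [n] whose coefficient of
   degree [n] is [c]; the factor theorem is built into the definition. *)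
Fixpoint poly_fun (n : nat) (c : R) (f : R -> R) : Prop :=
  match n with
  | O => forall t, f t = c
  | S m => forall a, exists g, poly_fun m c g /\ forall t, f t = f a + (t - a) * g t
  end.

Lemma poly_fun_ext (n : nat) (c d : R) (f g : R -> R) :
  poly_fun n c f -> c = d -> (forall t, f t = g t) -> poly_fun n d g.
Proof.
  intros Hf <- Hfg. destruct n as [|n]; cbn in *.
  - intros t. now rewrite <- Hfg.
  - intros a. destruct (Hf a) as [k [Hk E]]. exists k; split; [easy|].
    intros t. now rewrite <- !Hfg.
Qed.

Lemma poly_fun_plus (n : nat) (c d : R) (f g : R -> R) :
  poly_fun n c f -> poly_fun n d g -> poly_fun n (c + d) (fun t => f t + g t).
Proof.
  revert c d f g; induction n as [|n IH]; cbn; intros c d f g Hf Hg.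
  - intros t. now rewrite Hf, Hg.
  - intros a. destruct (Hf a) as [f1 [Hf1 Ef]], (Hg a) as [g1 [Hg1 Eg]].
    exists (fun t => f1 t + g1 t); split; [auto|].
    intros t. rewrite (Ef t), (Eg t). ring.
Qed.

Lemma poly_fun_scal (n : nat) (c k : R) (f : R -> R) :
  poly_fun n c f -> poly_fun n (k * c) (fun t => k * f t).
Proof.
  revert c f; induction n as [|n IH]; cbn; intros c f Hf.
  - intros t. now rewrite Hf.
  - intros a. destruct (Hf a) as [f1 [Hf1 Ef]].
    exists (fun t => k * f1 t); split; [auto|].
    intros t. rewrite (Ef t). ring.
Qed.

Lemma poly_fun_lift (n : nat) (c : R) (f : R -> R) :
  poly_fun n c f -> poly_fun (S n) 0 f.
Proof.
  revert c f; induction n as [|n IH]; intros c f Hf a.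
  - exists (fun _ => 0); split; [easy|]. intros t. rewrite (Hf t), (Hf a). ring.
  - destruct (Hf a) as [f1 [Hf1 Ef]]. exists f1; split; [eauto|easy].
Qed.

Lemma poly_fun_mulX (n : nat) (c : R) (f : R -> R) :
  poly_fun n c f -> poly_fun (S n) c (fun t => t * f t).
Proof.
  intros Hf a. destruct n as [|n].
  - exists f; split; [easy|]. intros t. rewrite (Hf t), (Hf a). ring.
  - destruct (Hf a) as [f1 [Hf1 Ef]].
    (* From [t f(t) - a f(a) = (t - a) f(t) + a (f(t) - f(a))]. *)
    exists (fun t => f t + a * f1 t); split.
    + eapply poly_fun_ext; [apply poly_fun_plus; [exact Hf|
        apply poly_fun_scal, (poly_fun_lift n c), Hf1]|ring|easy].
    + intros t. rewrite (Ef t). ring.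
Qed.

(** Splitting off [rho (S n)] leaves a quotient that vanishes at the other roots, as they differ
    from [rho (S n)]. *)
Lemma poly_fun_roots (n : nat) (c : R) (f : R -> R) (rho : nat -> R) :
  poly_fun n c f ->
  (forall j, (1 <= j <= n)%nat -> f (rho j) = 0) ->
  (forall i j, (1 <= i < j)%nat -> (j <= n)%nat -> rho i <> rho j) ->
  forall t, f t = c * prod1 (fun j => t - rho j) n.
Proof.
  revert c f; induction n as [|n IH]; intros c f Hf Hroot Hdist t; cbn.
  - rewrite (Hf t). ring.
  - destruct (Hf (rho (S n))) as [g [Hg E]].
    rewrite Hroot in E by lia.
    rewrite E, (IH c g Hg); [ring| |intros; apply Hdist; lia].
    intros j Hj.
    assert (H1 := E (rho j)). rewrite Hroot in H1 by lia.
    assert (H2 := Hdist j (S n) ltac:(lia) ltac:(lia)).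
    assert (H3 : (rho j - rho (S n)) * g (rho j) = 0) by lra.
    apply Rmult_integral in H3 as [H3|H3]; lra.
Qed.

(* Chebyshev polynomials of the second kind, shifted: [cheb (S n)] is U_n. *)
Fixpoint cheb (n : nat) (t : R) : R :=
  match n with
  | O => 0
  | S m => match m with
           | O => 1
           | S k => 2 * t * cheb m t - cheb k t
           end
  end.

Lemma cheb_SS (n : nat) (t : R) :
  cheb (S (S n)) t = 2 * t * cheb (S n) t - cheb n t.
Proof. reflexivity. Qed.

Lemma poly_fun_cheb (n : nat) : poly_fun n (2 ^ n) (cheb (S n)).
Proof.
  cut (poly_fun n (2 ^ n) (cheb (S n)) /\
       poly_fun (S n) (2 ^ S n) (cheb (S (S n)))); [tauto|].
  induction n as [|n [IH1 IH2]].
  - split; [easy|]. intros a. exists (fun _ => 2); cbn; split; intros; ring.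
  - split; [exact IH2|].
    eapply poly_fun_ext.
    + apply poly_fun_plus.
      * exact (poly_fun_scal _ _ 2 _ (poly_fun_mulX _ _ _ IH2)).
      * exact (poly_fun_scal _ _ (-1) _ (poly_fun_lift _ _ _ (poly_fun_lift _ _ _ IH1))).
    + cbn [pow]; ring.
    + intros t. rewrite (cheb_SS (S n)). ring.
Qed.

Lemma cheb_sin (n : nat) (v : R) : sin v * cheb n (cos v) = sin (INR n * v).
Proof.
  cut (sin v * cheb n (cos v) = sin (INR n * v) /\
       sin v * cheb (S n) (cos v) = sin (INR (S n) * v)); [tauto|].
  induction n as [|n [IH1 IH2]].
  - cbn. rewrite !Rmult_0_l, sin_0, Rmult_1_l. lra.
  - split; [exact IH2|].
    rewrite cheb_SS.
    replace (sin v * (2 * cos v * cheb (S n) (cos v) - cheb n (cos v)))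
      with (2 * cos v * (sin v * cheb (S n) (cos v)) - sin v * cheb n (cos v)) by ring.
    rewrite IH1, IH2.
    replace (INR n * v) with (INR (S n) * v - v) by (rewrite S_INR; ring).
    replace (INR (S (S n)) * v) with (INR (S n) * v + v) by (rewrite (S_INR (S n)); ring).
    rewrite sin_plus, sin_minus. ring.
Qed.

Lemma cheb_1 (n : nat) : cheb n 1 = INR n.
Proof.
  cut (cheb n 1 = INR n /\ cheb (S n) 1 = INR (S n)); [tauto|].
  induction n as [|n [IH1 IH2]]; [cbn; lra|].
  split; [exact IH2|]. rewrite cheb_SS, IH1, IH2, !S_INR. ring.
Qed.

Lemma frac_bounds (q j : nat) : (1 <= j <= q)%nat -> 0 < INR j / INR q <= 1.
Proof.
  intros Hj.
  assert (Hq : 0 < INR q) by (apply lt_0_INR; lia).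
  split; [apply Rdiv_lt_0_compat; [apply lt_0_INR; lia|easy]|].
  apply Rle_div_l; [easy|]. rewrite Rmult_1_l. apply le_INR; lia.
Qed.

Lemma frac_lt_1 (q j : nat) : (j < q)%nat -> INR j / INR q < 1.
Proof.
  intros Hj.
  assert (Hq : 0 < INR q) by (apply lt_0_INR; lia).
  apply Rlt_div_l; [easy|]. rewrite Rmult_1_l. now apply lt_INR.
Qed.

(** With [q = n + 1], the roots of [cheb q] are the [cos (pi j / q)], so its value [q] at 1 is the
    product of the [2 (1 - cos (pi j / q))], the squares of [2 sin (pi j / (2 q))]. Pairing [j] with
    [q - j] in one of the two copies turns sine into cosine, and the duplication formula recovers
    the full angle. *)
Lemma prod_sin (n : nat) :
  prod1 (fun j => 2 * sin (PI * (INR j / INR (S n)))) n = INR (S n).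
Proof.
  set (q := INR (S n)).
  assert (Hq : 0 < q) by (apply lt_0_INR; lia).
  assert (HPI := PI_RGT_0).
  assert (Hj : forall j, (1 <= j <= n)%nat -> 0 < PI * (INR j / q) < PI).
  { intros j H.
    assert (H1 := frac_bounds (S n) j ltac:(lia)).
    assert (H2 := frac_lt_1 (S n) j ltac:(lia)). fold q in H1, H2. nra. }
  assert (Hcos : prod1 (fun j => 2 * (1 - cos (PI * (INR j / q)))) n = q).
  { assert (Hpow : prod1 (fun _ => 2) n = 2 ^ n).
    { clear. induction n as [|n IH]; cbn; [easy|]. rewrite IH. ring. }
    rewrite prod1_mult, Hpow.
    rewrite <- (poly_fun_roots n (2 ^ n) (cheb (S n)) (fun j => cos (PI * (INR j / q)))).
    - apply cheb_1.
    - apply poly_fun_cheb.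
    - intros j H. specialize (Hj j H).
      apply Rmult_eq_reg_l with (sin (PI * (INR j / q)));
        [|apply Rgt_not_eq, sin_gt_0; lra].
      rewrite cheb_sin, Rmult_0_r. fold q.
      replace (q * (PI * (INR j / q))) with (INR j * PI) by (field; lra).
      apply sin_eq_0_1. exists (Z.of_nat j). now rewrite <- INR_IZR_INZ.
    - intros i j H1 H2.
      apply Rgt_not_eq, cos_decreasing_1; try apply Rlt_le, Hj; try lia.
      apply Rmult_lt_compat_l; [easy|]. apply Rmult_lt_compat_r.
      + now apply Rinv_0_lt_compat.
      + apply lt_INR; lia. }
  set (s := fun j => 2 * sin (PI * (INR j / q) / 2)).
  assert (Hsq : prod1 s n * prod1 s n = q).
  { rewrite <- prod1_mult. rewrite <- Hcos. apply big_ext. intros j _. unfold s.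
    replace (cos (PI * (INR j / q))) with (cos (2 * (PI * (INR j / q) / 2)))
      by (f_equal; field; lra).
    rewrite cos_2a_sin. ring. }
  transitivity (prod1 s n * prod1 s n); [symmetry|exact Hsq].
  rewrite <- (prod1_reindex (fun j => S n - j)%nat s n) at 2 by (intros; lia).
  rewrite <- prod1_mult. apply big_ext. intros j H. unfold s.
  rewrite minus_INR by lia. fold q.
  replace (PI * ((q - INR j) / q) / 2) with (PI / 2 - PI * (INR j / q) / 2)
    by (field; lra).
  rewrite sin_shift.
  replace (sin (PI * (INR j / q))) with (sin (2 * (PI * (INR j / q) / 2)))
    by (f_equal; field; lra).
  rewrite sin_2a. ring.
Qed.

(* The left side times [exp (- c v)] has derivative
   [- (1 + c^2) exp (- c v) sin v], so it is maximal at [v = 0]. *)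
Lemma cos_plus_scal_sin_le_exp (c v : R) :
  - PI <= v <= PI -> cos v + c * sin v <= exp (c * v).
Proof.
  intros Hv.
  set (h := fun x => exp (- (c * x)) * (cos x + c * sin x)).
  assert (Hd : forall x, is_derive h x (- (exp (- (c * x)) * (1 + c * c) * sin x))).
  { intros x. unfold h. auto_derive; [easy|]. ring. }
  assert (Hc : forall x, continuity_pt h x).
  { intros x. apply derivable_continuous_pt.
    exists (- (exp (- (c * x)) * (1 + c * c) * sin x)).
    apply is_derive_Reals, Hd. }
  assert (Hh : h v <= 1).
  { destruct (MVT_gen h 0 v _ (fun x _ => Hd x) (fun x _ => Hc x)) as [x [Hx E]].
    assert (H0 : h 0 = 1).
    { unfold h. rewrite Rmult_0_r, Ropp_0, exp_0, cos_0, sin_0. ring. }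
    assert (Hp : 0 < exp (- (c * x)) * (1 + c * c)).
    { apply Rmult_lt_0_compat; [apply exp_pos|nra]. }
    cut (0 <= sin x * v); [intros; nra|].
    destruct (Rle_dec 0 v) as [H|H].
    - rewrite Rmin_left, Rmax_right in Hx by lra.
      assert (0 <= sin x) by (apply sin_ge_0; lra). nra.
    - rewrite Rmin_right, Rmax_left in Hx by lra.
      assert (0 <= sin (- x)) by (apply sin_ge_0; lra).
      rewrite sin_neg in *. nra. }
  unfold h in Hh.
  assert (He : exp (- (c * v)) * exp (c * v) = 1).
  { rewrite <- exp_plus, Rplus_opp_l. apply exp_0. }
  assert (Hp := exp_pos (c * v)).
  replace (cos v + c * sin v)
    with (exp (c * v) * (exp (- (c * v)) * (cos v + c * sin v)))
    by (transitivity ((exp (- (c * v)) * exp (c * v)) * (cos v + c * sin v));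
        [ring|rewrite He; ring]).
  rewrite <- (Rmult_1_r (exp (c * v))) at 2. apply Rmult_le_compat_l; lra.
Qed.

Definition cot (y : R) : R := cos y / sin y.

(** The tangent bound for the concave function [ln sin]. Factoring [sin y] out of the addition
    formula leaves [cos v + cot y sin v], so that [y + v] may even leave the interval where sine is
    positive. *)
Lemma sin_shift_le (y v : R) :
  0 < y < PI -> - PI <= v <= PI -> sin (y + v) <= sin y * exp (v * cot y).
Proof.
  intros Hy Hv.
  assert (Hs : 0 < sin y) by (apply sin_gt_0; lra).
  replace (sin (y + v)) with (sin y * (cos v + cot y * sin v)).
  - apply Rmult_le_compat_l; [lra|]. rewrite (Rmult_comm v).
    now apply cos_plus_scal_sin_le_exp.
  - unfold cot. rewrite sin_plus. field. lra.
Qed.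

(* sin (y + v) sin (y - v) = sin^2 y - sin^2 v turns the upper bound for
   [sin (y - v)] into a lower bound for [sin (y + v)]. *)
Lemma sin_shift_ge (y v : R) :
  0 < y < PI -> 0 < y - v < PI -> 0 < y + v ->
  Rsqr (sin v / sin y) <= 1 ->
  sin y * exp (v * cot y) * (1 - Rsqr (sin v / sin y)) <= sin (y + v).
Proof.
  intros Hy Hm Hp Hsq.
  assert (Hs : 0 < sin y) by (apply sin_gt_0; lra).
  assert (Hsm : 0 < sin (y - v)) by (apply sin_gt_0; lra).
  assert (Hle := sin_shift_le y (- v) Hy ltac:(lra)).
  assert (E : sin (y + v) * sin (y - v) = sin y * sin y * (1 - Rsqr (sin v / sin y))).
  { unfold Rsqr. rewrite sin_plus, sin_minus.
    assert (H1 := sin2_cos2 y). assert (H2 := sin2_cos2 v). unfold Rsqr in H1, H2.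
    transitivity (sin y * sin y - sin v * sin v); [|field; lra].
    replace (sin y * sin y) with (sin y * sin y * (sin v * sin v + cos v * cos v))
      by (rewrite H2; ring).
    replace (sin v * sin v) with (sin v * sin v * (sin y * sin y + cos y * cos y)) at 2
      by (rewrite H1; ring).
    ring. }
  assert (He : exp (v * cot y) * exp (- v * cot y) = 1).
  { rewrite <- exp_plus. replace (v * cot y + - v * cot y) with 0 by ring. apply exp_0. }
  apply Rmult_le_reg_r with (sin (y - v)); [easy|]. rewrite E.
  assert (Hv := exp_pos (v * cot y)).
  set (x := 1 - Rsqr (sin v / sin y)) in *.
  assert (Hx : 0 <= x) by (unfold x; lra).
  replace (sin y * sin y * x)
    with (sin y * exp (v * cot y) * x * (sin y * exp (- v * cot y))).
  - apply Rmult_le_compat_l; [|exact Hle].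
    apply Rmult_le_pos; [apply Rmult_le_pos|]; lra.
  - transitivity (sin y * sin y * x * (exp (v * cot y) * exp (- v * cot y)));
      [ring|rewrite He; ring].
Qed.

(** Otherwise [cos (8 / 5)] would be nonnegative, whereas the Taylor polynomial of degree 4, an
    upper bound, is negative at [8 / 5]. *)
Lemma PI_lt_3_2 : PI < 16 / 5.
Proof.
  destruct (Rlt_or_le PI (16 / 5)) as [H|H]; [easy|].
  assert (H4 := PI_4).
  assert (Hc : 0 <= cos (8 / 5)) by (apply cos_ge_0; lra).
  assert (Hb := proj2 (pre_cos_bound (8 / 5) 0 ltac:(lra) ltac:(lra))).
  unfold cos_approx, cos_term in Hb. cbn in Hb. lra.
Qed.

Lemma sin_ge_half (x : R) : 0 <= x <= PI / 2 -> x / 2 <= sin x.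
Proof.
  intros Hx.
  assert (HPI := PI_lt_3_2).
  assert (Hb := proj1 (pre_sin_bound x 0 ltac:(lra) ltac:(lra))).
  unfold sin_approx, sin_term in Hb. cbn in Hb.
  assert (x * x <= 64 / 25) by nra. nra.
Qed.

Lemma cos_le_sin_div (x : R) : 0 <= x <= PI -> x * cos x <= sin x.
Proof.
  intros Hx.
  set (g := fun t => sin t - t * cos t).
  assert (Hd : forall t, is_derive g t (t * sin t)).
  { intros t. unfold g. auto_derive; [easy|]. ring. }
  assert (Hc : forall t, continuity_pt g t).
  { intros t. apply derivable_continuous_pt. exists (t * sin t).
    apply is_derive_Reals, Hd. }
  destruct (MVT_gen g 0 x _ (fun t _ => Hd t) (fun t _ => Hc t)) as [t [Ht E]].
  rewrite Rmin_left, Rmax_right in Ht by lra.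
  unfold g in E. rewrite sin_0 in E.
  assert (0 <= sin t) by (apply sin_ge_0; lra).
  assert (0 <= t * sin t) by (apply Rmult_le_pos; lra).
  assert (0 <= t * sin t * (x - 0)) by (apply Rmult_le_pos; lra).
  lra.
Qed.

Lemma cot_le_inv (x : R) : 0 < x < PI -> cot x <= / x.
Proof.
  intros Hx. assert (H := cos_le_sin_div x ltac:(lra)).
  assert (Hs : 0 < sin x) by (apply sin_gt_0; lra).
  unfold cot. apply Rle_div_l; [easy|].
  rewrite Rmult_comm. apply Rle_div_r; lra.
Qed.

Lemma cot_ge_0 (x : R) : 0 < x <= PI / 2 -> 0 <= cot x.
Proof.
  intros Hx. assert (HPI := PI_RGT_0).
  apply Rdiv_le_0_compat; [apply cos_ge_0; lra|apply sin_gt_0; lra].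
Qed.

Lemma cot_decr (x y : R) : 0 < x -> x <= y -> y <= PI / 2 -> cot y <= cot x.
Proof.
  intros Hx Hxy Hy. assert (HPI := PI_RGT_0).
  unfold cot. apply Rmult_le_compat.
  - apply cos_ge_0; lra.
  - apply Rlt_le, Rinv_0_lt_compat, sin_gt_0; lra.
  - apply cos_decr_1; lra.
  - apply Rinv_le_contravar; [apply sin_gt_0; lra|apply sin_incr_1; lra].
Qed.

(** The cotangent changes sign on [(0, pi)]. This writes it as a difference of two nonnegative
    monotone pieces exchanged by [x -> pi - x], so that summation by parts needs a single decreasing
    weight. *)
Lemma cot_half (x : R) :
  0 < x < PI -> cot x = / 2 * cot (x / 2) - / 2 * cot ((PI - x) / 2).
Proof.
  intros Hx.
  assert (Hs : 0 < sin (x / 2)) by (apply sin_gt_0; lra).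
  assert (Hc : 0 < cos (x / 2)) by (apply cos_gt_0; lra).
  unfold cot.
  replace ((PI - x) / 2) with (PI / 2 - x / 2) by field.
  rewrite cos_shift, sin_shift.
  replace x with (2 * (x / 2)) at 1 2 by field.
  rewrite cos_2a, sin_2a. field. lra.
Qed.

(** * Continuants and sums over blocks *)

Fixpoint cf_den (c : nat -> nat) (n : nat) : nat :=
  match n with
  | O => 1
  | S m => match m with
           | O => c 1%nat
           | S k => c n * cf_den c m + cf_den c k
           end
  end%nat.

Fixpoint cf_num (c : nat -> nat) (n : nat) : nat :=
  match n with
  | O => 0
  | S m => match m with
           | O => 1
           | S k => c n * cf_num c m + cf_num c k
           end
  end%nat.

Lemma cf_den_SS (c : nat -> nat) (n : nat) :
  cf_den c (S (S n)) = (c (S (S n)) * cf_den c (S n) + cf_den c n)%nat.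
Proof. reflexivity. Qed.

Lemma cf_num_SS (c : nat -> nat) (n : nat) :
  cf_num c (S (S n)) = (c (S (S n)) * cf_num c (S n) + cf_num c n)%nat.
Proof. reflexivity. Qed.

Definition positive_seq (c : nat -> nat) : Prop := forall j, (1 <= j)%nat -> (0 < c j)%nat.

Lemma cf_den_mono (c : nat -> nat) (n : nat) :
  positive_seq c -> (0 < cf_den c n <= cf_den c (S n))%nat.
Proof.
  intros Hc; induction n as [|n IH].
  - cbn. specialize (Hc 1%nat). lia.
  - rewrite cf_den_SS. specialize (Hc (S (S n))). nia.
Qed.

Lemma cf_den_le (c : nat -> nat) (m n : nat) :
  positive_seq c -> (m <= n)%nat -> (cf_den c m <= cf_den c n)%nat.
Proof.
  intros Hc; induction 1 as [|n _ IH]; [lia|].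
  assert (H := cf_den_mono c n Hc). lia.
Qed.

Lemma cf_den_ge (c : nat -> nat) (n : nat) : positive_seq c -> (n <= cf_den c n)%nat.
Proof.
  intros Hc.
  cut (n <= cf_den c n /\ S n <= cf_den c (S n))%nat; [tauto|].
  induction n as [|n [IH1 IH2]].
  - cbn. specialize (Hc 1%nat). lia.
  - split; [easy|]. rewrite cf_den_SS. assert (Hn := Hc (S (S n))).
    assert (H := cf_den_mono c n Hc). nia.
Qed.

Lemma cf_den_step_ge (c : nat -> nat) (n : nat) :
  (c (S n) * cf_den c n <= cf_den c (S n))%nat.
Proof. destruct n as [|n]; [cbn; lia|]. rewrite cf_den_SS. lia. Qed.

Lemma cf_den_step_le (c : nat -> nat) (n : nat) :
  positive_seq c -> (cf_den c (S n) <= (c (S n) + 1) * cf_den c n)%nat.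
Proof.
  intros Hc. destruct n as [|n]; [cbn; lia|]. rewrite cf_den_SS.
  assert (H := cf_den_mono c n Hc). lia.
Qed.

Lemma cf_det (c : nat -> nat) (n : nat) :
  (Z.of_nat (cf_den c (S n)) * Z.of_nat (cf_num c n)
   - Z.of_nat (cf_den c n) * Z.of_nat (cf_num c (S n)) = - (-1) ^ Z.of_nat n)%Z.
Proof.
  induction n as [|n IH]; [cbn; lia|].
  rewrite cf_den_SS, cf_num_SS, Nat2Z.inj_succ, Z.pow_succ_r by lia. nia.
Qed.

Lemma sign_cases (n : nat) : ((-1) ^ Z.of_nat n = 1 \/ (-1) ^ Z.of_nat n = -1)%Z.
Proof.
  induction n as [|n IH]; [now left|].
  rewrite Nat2Z.inj_succ, Z.pow_succ_r by lia. lia.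
Qed.

Lemma cf_num_den_coprime (c : nat -> nat) (n : nat) :
  Z.gcd (Z.of_nat (cf_den c n)) (Z.of_nat (cf_num c n)) = 1%Z.
Proof.
  assert (H := cf_det c n).
  apply Z.bezout_1_gcd.
  destruct (sign_cases n) as [E|E]; rewrite E in H.
  - exists (Z.of_nat (cf_num c (S n))), (- Z.of_nat (cf_den c (S n)))%Z. lia.
  - exists (- Z.of_nat (cf_num c (S n)))%Z, (Z.of_nat (cf_den c (S n)))%Z. lia.
Qed.

Lemma cf_den_coprime (c : nat -> nat) (n : nat) :
  Z.gcd (Z.of_nat (cf_den c (S n))) (Z.of_nat (cf_den c n)) = 1%Z.
Proof.
  assert (H := cf_det c n).
  apply Z.bezout_1_gcd.
  destruct (sign_cases n) as [E|E]; rewrite E in H.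
  - exists (- Z.of_nat (cf_num c n))%Z, (Z.of_nat (cf_num c (S n)))%Z. lia.
  - exists (Z.of_nat (cf_num c n)), (- Z.of_nat (cf_num c (S n)))%Z. lia.
Qed.

(* The partial quotients of [cf_den c (n - 1) / cf_den c n = [0; c_n, ..., c_1]];
   the truncated subtraction keeps the sequence positive beyond index [n]. *)
Definition reversed (c : nat -> nat) (n i : nat) : nat := c (S (n - i)).

Lemma reversed_positive (c : nat -> nat) (n : nat) :
  positive_seq c -> positive_seq (reversed c n).
Proof. intros Hc j _. apply Hc. lia. Qed.

(** Euler's rule: the continuant of [c_1, ..., c_n] is split between the indices [k + 1] and
    [k + 2], the upper part being read backwards. *)
Lemma cf_den_reversed (c : nat -> nat) (n i k : nat) :
  n = (i + k + 2)%nat ->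
  (cf_den (reversed c n) (S i) * cf_den c (S k)
   + cf_den (reversed c n) i * cf_den c k = cf_den c n)%nat.
Proof.
  revert k; induction i as [|i IH]; intros k Hn.
  - replace n with (S (S k)) by lia. rewrite cf_den_SS.
    cbn [cf_den]. unfold reversed. replace (S (S (S k) - 1)) with (S (S k)) by lia.
    lia.
  - rewrite cf_den_SS. rewrite <- (IH (S k)) by lia. rewrite (cf_den_SS c k).
    unfold reversed at 1. replace (S (n - S (S i))) with (S (S k)) by lia.
    lia.
Qed.

Lemma cf_den_reversed_full (c : nat -> nat) (n : nat) :
  cf_den (reversed c n) n = cf_den c n.
Proof.
  destruct n as [|[|n]]; [easy|easy|].
  rewrite <- (cf_den_reversed c (S (S n)) n 0) by lia.
  rewrite cf_den_SS. unfold reversed at 1.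
  replace (S (S (S n) - S (S n))) with 1%nat by lia. cbn [cf_den]. lia.
Qed.

(** These are the approximation errors of the convergents of [q_(n-1) / q_n]. Both sides obey the
    same recurrence in [i], on the right the recurrence of [cf_den c] run downwards. *)
Lemma cf_reversed_approx (c : nat -> nat) (n i k : nat) :
  n = (i + k + 1)%nat ->
  (Z.of_nat (cf_den (reversed c n) i) * Z.of_nat (cf_den c (n - 1))
   - Z.of_nat (cf_num (reversed c n) i) * Z.of_nat (cf_den c n)
   = (-1) ^ Z.of_nat i * Z.of_nat (cf_den c k))%Z.
Proof.
  intros Hn.
  cut (forall k, n = (i + k + 1)%nat ->
    (Z.of_nat (cf_den (reversed c n) i) * Z.of_nat (cf_den c (n - 1))
     - Z.of_nat (cf_num (reversed c n) i) * Z.of_nat (cf_den c n)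
     = (-1) ^ Z.of_nat i * Z.of_nat (cf_den c k))%Z
    /\ forall k', k = S k' ->
    (Z.of_nat (cf_den (reversed c n) (S i)) * Z.of_nat (cf_den c (n - 1))
     - Z.of_nat (cf_num (reversed c n) (S i)) * Z.of_nat (cf_den c n)
     = (-1) ^ Z.of_nat (S i) * Z.of_nat (cf_den c k'))%Z).
  { intros H. now apply H. }
  clear k Hn. induction i as [|i IH]; intros k Hn.
  - split.
    + cbn [cf_den cf_num Z.of_nat Z.pow]. replace (n - 1)%nat with k by lia. lia.
    + intros k' ->. replace n with (S (S k')) by lia. rewrite (cf_den_SS c k').
      replace (S (S k') - 1)%nat with (S k') by lia. cbn [cf_den cf_num].
      unfold reversed. replace (S (S (S k') - 1))%nat with (S (S k')) by lia.
      change ((-1) ^ Z.of_nat 1)%Z with (-1)%Z. lia.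
  - destruct (IH (S k) ltac:(lia)) as [IH1 IH2].
    specialize (IH2 k eq_refl). split; [exact IH2|].
    intros k' ->.
    rewrite cf_den_SS, cf_num_SS.
    assert (Hr : reversed c n (S (S i)) = c (S (S k'))) by (unfold reversed; f_equal; lia).
    rewrite Hr.
    rewrite (cf_den_SS c k') in IH1.
    rewrite !Nat2Z.inj_add, !Nat2Z.inj_mul in *.
    rewrite Nat2Z.inj_succ, Z.pow_succ_r in IH2 by lia.
    rewrite !Nat2Z.inj_succ, !Z.pow_succ_r by lia.
    set (x := ((-1) ^ Z.of_nat i)%Z) in *. set (C := Z.of_nat (c (S (S k')))) in *.
    match type of IH1 with ?l1 = ?r1 => match type of IH2 with ?l2 = ?r2 =>
      transitivity (C * l2 + l1)%Z; [ring|rewrite IH1, IH2; ring] end end.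
Qed.

(** * Residues and integer parts along arithmetic progressions *)

Lemma coprime_affine_inj (Q P z i j : Z) :
  (0 < Q)%Z -> Z.gcd Q P = 1%Z -> (Z.abs (i - j) < Q)%Z ->
  ((z + i * P) mod Q = (z + j * P) mod Q)%Z -> i = j.
Proof.
  intros HQ Hg Hij E.
  assert (Hd : (Q | P * (i - j))%Z).
  { exists ((z + i * P) / Q - (z + j * P) / Q)%Z.
    assert (H1 := Z.div_mod (z + i * P) Q ltac:(lia)).
    assert (H2 := Z.div_mod (z + j * P) Q ltac:(lia)).
    rewrite E in H1. lia. }
  apply Z.gauss in Hd; [|easy].
  destruct Hd as [x Hx].
  assert (x = 0)%Z by nia. lia.
Qed.

Lemma sum_residues (Q : nat) (P z : Z) :
  (0 < Q)%nat -> Z.gcd (Z.of_nat Q) P = 1%Z ->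
  2 * sum1 (fun i => IZR ((z + Z.of_nat i * P) mod Z.of_nat Q)) Q = INR Q * (INR Q - 1).
Proof.
  intros HQ Hg.
  (* The successor moves the residues from [0, ..., Q - 1] into the index range [1, ..., Q]. *)
  set (phi := fun i => S (Z.to_nat ((z + Z.of_nat i * P) mod Z.of_nat Q))).
  assert (Hb : forall i, (0 <= (z + Z.of_nat i * P) mod Z.of_nat Q < Z.of_nat Q)%Z).
  { intros i. apply Z.mod_pos_bound. lia. }
  assert (E : sum1 (fun i => INR (phi i)) Q = sum1 INR Q).
  { apply (sum1_reindex phi INR).
    - intros j _. unfold phi. specialize (Hb j). lia.
    - intros i j Hi Hj. unfold phi. intros E.
      assert (Hi' := Hb i). assert (Hj' := Hb j).
      apply Nat2Z.inj, (coprime_affine_inj (Z.of_nat Q) P z); [lia|easy|lia|lia]. }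
  rewrite (big_ext _ _ _
    (fun i => IZR ((z + Z.of_nat i * P) mod Z.of_nat Q) + 1)) in E.
  - rewrite sum1_plus, sum1_const in E. assert (H := sum1_id Q). lra.
  - intros j _. unfold phi. rewrite S_INR, INR_IZR_INZ, Z2Nat.id by apply Hb. easy.
Qed.

(** The division identity is summed over the progression, the residues being a full system. Raising
    [z] by one thus raises the sum of integer parts by exactly one. *)
Lemma sum_floor (Q : nat) (P z : Z) :
  (0 < Q)%nat -> Z.gcd (Z.of_nat Q) P = 1%Z ->
  2 * sum1 (fun i => IZR ((z + Z.of_nat i * P) / Z.of_nat Q)) Q
  = 2 * IZR z + IZR P * (INR Q + 1) - (INR Q - 1).
Proof.
  intros HQ Hg.
  assert (HQ' : 0 < INR Q) by now apply lt_0_INR.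
  assert (Hr := sum_residues Q P z HQ Hg).
  assert (E : sum1 (fun i => INR Q * IZR ((z + Z.of_nat i * P) / Z.of_nat Q)
                      + IZR ((z + Z.of_nat i * P) mod Z.of_nat Q)) Q
              = sum1 (fun i => IZR z + IZR P * INR i) Q).
  { apply big_ext. intros i _.
    rewrite !INR_IZR_INZ, <- !mult_IZR, <- !plus_IZR. f_equal.
    rewrite <- Z.div_mod by lia. ring. }
  rewrite !sum1_plus, !sum1_scal, sum1_const in E.
  assert (H := sum1_id Q).
  set (F := sum1 (fun i => IZR ((z + Z.of_nat i * P) / Z.of_nat Q)) Q) in *.
  apply Rmult_eq_reg_l with (INR Q); [|lra]. nra.
Qed.

(* In terms of the sawtooth [B t = {t} - 1/2] this says that
   [B (j m / q)], summed over [Q] consecutive [j], is at most 1 in absolute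
   value.  With [m / q = P / Q + sigma / (q Q)], each [j m / q] deviates from an
   arithmetic progression of step [P / Q] by at most [1 / (2 Q)], which
   determines the sum of the integer parts up to 1. *)
Lemma block_sum_bound (q m Q : nat) (P sigma : Z) (s : nat) :
  (0 < q)%nat -> (0 < Q)%nat -> Z.gcd (Z.of_nat Q) P = 1%Z ->
  (Z.of_nat Q * Z.of_nat m - P * Z.of_nat q = sigma)%Z ->
  (Z.abs sigma * Z.of_nat Q <= Z.of_nat q)%Z ->
  Rabs (sum1 (fun i => 2 * INR (((s + i) * m) mod q) - INR q) Q) <= 2 * INR q.
Proof.
  intros Hq HQ Hg Hsig Hsmall.
  assert (HqR : 0 < INR q) by now apply lt_0_INR.
  assert (HQR : 0 < INR Q) by now apply lt_0_INR.
  set (q' := Z.of_nat q) in *. set (Q' := Z.of_nat Q) in *.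
  set (m' := Z.of_nat m) in *. set (s' := Z.of_nat s).
  (* Up to the factor [2 * q'], this is the start of a progression of step [P] centred at the middle
     index [(Q' + 1) / 2], raised by the largest deviation [q']. The deviations span at most
     [2 * q'], so every integer part lies between those obtained from [z - 1] and from [z]. *)
  set (u := (2 * Q' * s' * m' + (Q' + 1) * sigma + q')%Z).
  set (z := (u / (2 * q'))%Z).
  assert (Hz : (2 * q' * z <= u < 2 * q' * z + 2 * q')%Z).
  { assert (H1 := Z.div_mod u (2 * q') ltac:(lia)).
    assert (H2 := Z.mod_pos_bound u (2 * q') ltac:(lia)). fold z in H1. lia. }
  set (fl := fun i : nat => ((s' + Z.of_nat i) * m' / q')%Z).
  assert (Hfl : forall i, (1 <= i <= Q)%nat ->
    ((z - 1 + Z.of_nat i * P) / Q' <= fl i <= (z + Z.of_nat i * P) / Q')%Z).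
  { intros i Hi.
    set (t := ((s' + Z.of_nat i) * m')%Z).
    assert (Hf1 := Z.div_mod t q' ltac:(lia)).
    assert (Hf2 := Z.mod_pos_bound t q' ltac:(lia)).
    assert (Ht : (2 * Q' * t = u - q' + (2 * Z.of_nat i - Q' - 1) * sigma
      + 2 * q' * (Z.of_nat i * P))%Z).
    { unfold t, u.
      replace (2 * Q' * ((s' + Z.of_nat i) * m'))%Z
        with (2 * Q' * s' * m' + 2 * Z.of_nat i * (Q' * m'))%Z by ring.
      replace (Q' * m')%Z with (sigma + P * q')%Z by lia. ring. }
    assert (Hdev : (- q' <= (2 * Z.of_nat i - Q' - 1) * sigma <= q')%Z).
    { apply Z.abs_le. rewrite Z.abs_mul.
      apply Z.le_trans with (Q' * Z.abs sigma)%Z; [|lia].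
      apply Z.mul_le_mono_nonneg_r; lia. }
    fold t in Hf1, Hf2 |- *. change (fl i) with (t / q')%Z. split.
    - apply Z.div_le_lower_bound; [lia|].
      set (w := ((z - 1 + Z.of_nat i * P) / Q')%Z).
      assert (Hw1 := Z.div_mod (z - 1 + Z.of_nat i * P) Q' ltac:(lia)).
      assert (Hw2 := Z.mod_pos_bound (z - 1 + Z.of_nat i * P) Q' ltac:(lia)).
      fold w in Hw1.
      apply (Z.mul_le_mono_pos_l _ _ (2 * Q')); [lia|].
      rewrite Ht.
      apply Z.le_trans with (2 * q' * (z - 1 + Z.of_nat i * P))%Z; [|lia].
      rewrite Hw1. nia.
    - apply Z.div_le_lower_bound; [lia|].
      set (w := (t / q')%Z) in *.
      assert (H : (2 * q' * (Q' * w) < 2 * q' * (z + Z.of_nat i * P + 1))%Z) by nia.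
      apply Z.mul_lt_mono_pos_l in H; lia. }
  assert (Hsum1 := sum_floor Q P (z - 1) HQ Hg). fold Q' in Hsum1.
  assert (Hsum2 := sum_floor Q P z HQ Hg). fold Q' in Hsum2.
  set (F := sum1 (fun i => IZR (fl i)) Q).
  assert (HF1 : sum1 (fun i => IZR ((z - 1 + Z.of_nat i * P) / Q')) Q <= F).
  { apply sum1_le. intros i Hi. apply IZR_le, Hfl, Hi. }
  assert (HF2 : F <= sum1 (fun i => IZR ((z + Z.of_nat i * P) / Q')) Q).
  { apply sum1_le. intros i Hi. apply IZR_le, Hfl, Hi. }
  assert (E : sum1 (fun i => 2 * INR (((s + i) * m) mod q) - INR q) Q
     = INR m * (2 * INR s * INR Q + INR Q * (INR Q + 1)) - INR q * INR Q
       - 2 * INR q * F).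
  { rewrite (big_ext _ _ _ (fun i => (2 * INR s * INR m - INR q)
      + ((2 * INR m) * INR i + (- (2 * INR q)) * IZR (fl i)))).
    - rewrite !sum1_plus, !sum1_scal, sum1_const. fold F.
      assert (H := sum1_id Q). nra.
    - intros i _. unfold fl, q', m', s'.
      rewrite <- Nat2Z.inj_add, <- Nat2Z.inj_mul, <- Nat2Z.inj_div, <- INR_IZR_INZ.
      assert (H := Nat.div_mod ((s + i) * m) q ltac:(lia)).
      apply (f_equal INR) in H.
      rewrite plus_INR, !mult_INR, plus_INR in H. lra. }
  assert (HsigR : INR Q * INR m - IZR P * INR q = IZR sigma).
  { rewrite <- Hsig, !INR_IZR_INZ. unfold Q', m', q'.
    now rewrite minus_IZR, !mult_IZR. }
  assert (HuR : IZR u = 2 * INR Q * INR s * INR m + (INR Q + 1) * IZR sigma + INR q).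
  { unfold u, Q', m', q', s'. now rewrite !plus_IZR, !mult_IZR, plus_IZR, <- !INR_IZR_INZ. }
  destruct Hz as [Hz1 Hz2].
  apply IZR_le in Hz1. apply IZR_lt in Hz2.
  rewrite plus_IZR, !mult_IZR in Hz2. rewrite !mult_IZR in Hz1.
  unfold q' in Hz1, Hz2. rewrite <- !INR_IZR_INZ in Hz1, Hz2.
  rewrite minus_IZR in Hsum1.
  assert (E2 : sum1 (fun i => 2 * INR (((s + i) * m) mod q) - INR q) Q
     = IZR u - INR q + INR q * (IZR P * (INR Q + 1)) - INR q * INR Q - INR q * (2 * F)).
  { rewrite E, HuR, <- HsigR. ring. }
  rewrite E2.
  set (K := IZR P * (INR Q + 1)) in *.
  assert (H1 : INR q * (2 * IZR z - 2 + K - (INR Q - 1)) <= INR q * (2 * F)).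
  { apply Rmult_le_compat_l; lra. }
  assert (H2 : INR q * (2 * F) <= INR q * (2 * IZR z + K - (INR Q - 1))).
  { apply Rmult_le_compat_l; lra. }
  apply Rabs_le. lra.
Qed.

(** * The cotangent sum *)

Definition harmonic (d : nat) : R := sum1 (fun t => / INR t) d.

Lemma harmonic_mono (d e : nat) : (d <= e)%nat -> harmonic d <= harmonic e.
Proof.
  induction 1 as [|e _ IH]; [lra|].
  unfold harmonic in *. cbn [big].
  assert (0 < / INR (S e)) by (apply Rinv_0_lt_compat, lt_0_INR; lia). lra.
Qed.

Lemma harmonic_ge_0 (d : nat) : 0 <= harmonic d.
Proof. apply (harmonic_mono 0). lia. Qed.

(** The increment is 1 exactly at the multiples [t Q] with [t <= d], where the weight is
    [1 / (t Q)], and 0 elsewhere. *)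
Lemma sum_min_div_increments (d Q M : nat) :
  (0 < Q)%nat ->
  sum1 (fun j => (INR (Nat.min d (j / Q)) - INR (Nat.min d ((j - 1) / Q))) * / INR j) M
  = harmonic (Nat.min d (M / Q)) / INR Q.
Proof.
  intros HQ.
  assert (HQR : 0 < INR Q) by now apply lt_0_INR.
  induction M as [|M IH].
  - cbn [big]. rewrite Nat.Div0.div_0_l, Nat.min_0_r. unfold harmonic; cbn. field; lra.
  - cbn [big]. rewrite IH. replace (S M - 1)%nat with M by lia.
    assert (H1 := Nat.div_mod M Q ltac:(lia)).
    assert (H2 := Nat.mod_upper_bound M Q ltac:(lia)).
    assert (H3 := Nat.div_mod (S M) Q ltac:(lia)).
    assert (H4 := Nat.mod_upper_bound (S M) Q ltac:(lia)).
    assert (H5 : (S M / Q = M / Q \/ (S M / Q = S (M / Q) /\ S M = Q * S (M / Q)))%nat) by nia.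
    destruct H5 as [->|[-> HM]]; [lra|].
    destruct (Nat.le_gt_cases d (M / Q)) as [H|H].
    + rewrite !Nat.min_l by lia. lra.
    + rewrite !Nat.min_r by lia. rewrite HM, mult_INR. unfold harmonic. cbn [big].
      assert (0 < INR (S (M / Q))) by (apply lt_0_INR; lia).
      rewrite S_INR in *. field. lra.
Qed.

(* Greedy (Ostrowski) expansion: an interval of length [N < cf_den c n] is cut
   into at most [min (c t) (N / cf_den c (t - 1))] blocks of length
   [cf_den c (t - 1)], for [t = 1, ..., n]. *)
Lemma greedy_sum_bound (f : nat -> R) (c : nat -> nat) (K : R) (n : nat) :
  positive_seq c ->
  (forall i s, (i < n)%nat -> Rabs (sum1 (fun j => f (s + j)%nat) (cf_den c i)) <= K) ->
  forall N s, (N < cf_den c n)%nat ->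
  Rabs (sum1 (fun j => f (s + j)%nat) N)
  <= K * sum1 (fun t => INR (Nat.min (c t) (N / cf_den c (t - 1)))) n.
Proof.
  intros Hc; induction n as [|n IH]; intros Hblock N s HN.
  - cbn in HN. replace N with O by lia. cbn. rewrite Rabs_R0. lra.
  - set (Q := cf_den c n).
    assert (HQ : (0 < Q)%nat) by apply (cf_den_mono c n Hc).
    assert (HK : 0 <= K).
    { eapply Rle_trans; [apply Rabs_pos|apply (Hblock O O); lia]. }
    assert (Hrep : forall b s, Rabs (sum1 (fun j => f (s + j)%nat) (b * Q)) <= INR b * K).
    { clear s. induction b as [|b IHb]; intros s; [cbn; rewrite Rabs_R0; lra|].
      replace (S b * Q)%nat with (b * Q + Q)%nat by lia. rewrite sum1_app, S_INR.
      eapply Rle_trans; [apply Rabs_triang|]. rewrite Rmult_plus_distr_r, Rmult_1_l.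
      apply Rplus_le_compat; [apply IHb|].
      rewrite (big_ext _ _ _ (fun j => f (s + b * Q + j)%nat))
        by (intros; f_equal; lia).
      apply Hblock; lia. }
    assert (HNQ := Nat.div_mod N Q ltac:(lia)).
    assert (HNr := Nat.mod_upper_bound N Q ltac:(lia)).
    set (b := (N / Q)%nat) in *. set (r := (N mod Q)%nat) in *.
    assert (Hb : (b <= c (S n))%nat).
    { assert (H := cf_den_step_le c n Hc). fold Q in H. nia. }
    cbn [big]. replace (S n - 1)%nat with n by lia. fold Q b.
    rewrite (Nat.min_r (c (S n)) b) by lia.
    replace N with (b * Q + r)%nat at 1 by lia. rewrite sum1_app.
    eapply Rle_trans; [apply Rabs_triang|].
    rewrite Rmult_plus_distr_l, Rplus_comm, (Rmult_comm K (INR b)).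
    apply Rplus_le_compat; [|apply Hrep].
    rewrite (big_ext _ _ _ (fun j => f (s + b * Q + j)%nat)) by (intros; f_equal; lia).
    eapply Rle_trans; [apply IH; [intros; apply Hblock; lia|exact HNr]|].
    apply Rmult_le_compat_l; [easy|]. apply sum1_le. intros t _. apply le_INR.
    apply Nat.min_le_compat_l, Nat.Div0.div_le_mono. lia.
Qed.

(** The increments [g] of the bound on the partial sums serve as a majorant: [g + f] and [g - f]
    have nonnegative partial sums, so Abel summation bounds the weighted sum of [f] by that of [g].
    With [w j <= W / j] and the sums exchanged, each [t] contributes a harmonic number divided by
    its block length. *)
Lemma weighted_sum_bound (f w : nat -> R) (c : nat -> nat) (K W : R) (n M : nat) :
  positive_seq c -> 0 <= K -> 0 <= W ->
  (forall j, (1 <= j <= M)%nat -> 0 <= w j <= W * / INR j) ->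
  (forall j, (1 <= j < M)%nat -> w (S j) <= w j) ->
  (forall N, (N <= M)%nat -> Rabs (sum1 f N)
     <= K * sum1 (fun t => INR (Nat.min (c t) (N / cf_den c (t - 1)))) n) ->
  Rabs (sum1 (fun j => f j * w j) M)
  <= K * W * sum1 (fun t => harmonic (c t) / INR (cf_den c (t - 1))) n.
Proof.
  intros Hc HK HW Hw Hdec Hf.
  set (G := fun N => sum1 (fun t => INR (Nat.min (c t) (N / cf_den c (t - 1)))) n) in *.
  set (g := fun j => K * (G j - G (j - 1)%nat)).
  assert (HQ : forall t, (0 < cf_den c t)%nat) by (intros t; apply (cf_den_mono c t Hc)).
  assert (Hg : forall N, sum1 g N = K * G N).
  { assert (G0 : G O = 0).
    { unfold G. rewrite (big_ext _ _ _ (fun _ => 0)); [rewrite sum1_const; ring|].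
      intros t _. now rewrite Nat.Div0.div_0_l, Nat.min_0_r. }
    induction N as [|N IH]; cbn [big]; [rewrite G0; ring|].
    rewrite IH. unfold g. replace (S N - 1)%nat with N by lia. ring. }
  assert (Hgw : sum1 (fun j => g j * w j) M
    <= K * W * sum1 (fun t => harmonic (c t) / INR (cf_den c (t - 1))) n).
  { apply Rle_trans with (sum1 (fun j => (K * W) * ((G j - G (j - 1)%nat) * / INR j)) M).
    - apply sum1_le. intros j Hj. specialize (Hw j Hj). unfold g.
      assert (0 <= G j - G (j - 1)%nat).
      { apply Rge_le, Rge_minus, Rle_ge. apply sum1_le. intros t _. apply le_INR.
        apply Nat.min_le_compat_l, Nat.Div0.div_le_mono. lia. }
      replace (K * W * ((G j - G (j - 1)%nat) * / INR j))
        with (K * (G j - G (j - 1)%nat) * (W * / INR j)) by ring.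
      apply Rmult_le_compat_l; [now apply Rmult_le_pos|lra].
    - rewrite sum1_scal. apply Rmult_le_compat_l; [now apply Rmult_le_pos|].
      rewrite (big_ext _ _ _ (fun j => sum1 (fun t =>
        (INR (Nat.min (c t) (j / cf_den c (t - 1)))
         - INR (Nat.min (c t) ((j - 1) / cf_den c (t - 1)))) * / INR j) n)).
      + rewrite <- (sum1_exchange (fun t j =>
          (INR (Nat.min (c t) (j / cf_den c (t - 1)))
           - INR (Nat.min (c t) ((j - 1) / cf_den c (t - 1)))) * / INR j)).
        apply sum1_le. intros t _. rewrite sum_min_div_increments by apply HQ.
        apply Rmult_le_compat_r;
          [apply Rlt_le, Rinv_0_lt_compat, lt_0_INR, HQ|].
        apply harmonic_mono. lia.
      + intros j _. unfold G.
        rewrite <- (Rmult_comm (/ INR j)).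
        rewrite (big_ext _ _ (fun t : nat => (_ - _) * _) (fun t => / INR j *
          (INR (Nat.min (c t) (j / cf_den c (t - 1)))
           + (-1) * INR (Nat.min (c t) ((j - 1) / cf_den c (t - 1))))))
          by (intros; ring).
        rewrite sum1_scal, sum1_plus, sum1_scal. ring. }
  apply Rabs_le. split.
  - assert (H := abel_nonneg (fun j => g j + f j) w M).
    assert (E : sum1 (fun j => (g j + f j) * w j) M
      = sum1 (fun j => g j * w j) M + sum1 (fun j => f j * w j) M).
    { rewrite <- sum1_plus. apply big_ext. intros; ring. }
    cbv beta in H. rewrite E in H. cut (0 <= sum1 (fun j => g j * w j) M + sum1 (fun j => f j * w j) M); [lra|].
    apply H; [intros; now apply Hw|exact Hdec|].
    intros N HN. rewrite sum1_plus, Hg. specialize (Hf N HN).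
    apply Rabs_le_between in Hf. unfold G. lra.
  - assert (H := abel_nonneg (fun j => g j + (-1) * f j) w M).
    assert (E : sum1 (fun j => (g j + (-1) * f j) * w j) M
      = sum1 (fun j => g j * w j) M + (-1) * sum1 (fun j => f j * w j) M).
    { rewrite <- sum1_scal, <- sum1_plus. apply big_ext. intros; ring. }
    cbv beta in H. rewrite E in H.
    cut (0 <= sum1 (fun j => g j * w j) M + (-1) * sum1 (fun j => f j * w j) M); [lra|].
    apply H; [intros; now apply Hw|exact Hdec|].
    intros N HN. rewrite sum1_plus, sum1_scal, Hg. specialize (Hf N HN).
    apply Rabs_le_between in Hf. unfold G. lra.
Qed.

Lemma coprime_mul_mod_inj (q m i j : nat) :
  Z.gcd (Z.of_nat q) (Z.of_nat m) = 1%Z -> (i < q)%nat -> (j < q)%nat ->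
  ((i * m) mod q = (j * m) mod q)%nat -> i = j.
Proof.
  intros Hg Hi Hj E.
  apply Nat2Z.inj, (coprime_affine_inj (Z.of_nat q) (Z.of_nat m) 0); [lia|easy|lia|].
  rewrite !Z.add_0_l, <- !Nat2Z.inj_mul, <- !Nat2Z.inj_mod. now rewrite E.
Qed.

Lemma coprime_mul_mod_range (q m j : nat) :
  Z.gcd (Z.of_nat q) (Z.of_nat m) = 1%Z -> (1 <= j <= q - 1)%nat ->
  (1 <= (j * m) mod q <= q - 1)%nat.
Proof.
  intros Hg Hj.
  assert (H := Nat.mod_upper_bound (j * m) q ltac:(lia)).
  assert ((j * m) mod q <> 0)%nat; [|lia].
  intros E. assert (j = 0)%nat; [|lia].
  apply (coprime_mul_mod_inj q m); [easy|lia|lia|].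
  rewrite E, Nat.mul_0_l, Nat.Div0.mod_0_l. easy.
Qed.

Lemma mul_mod_opp (q m j : nat) :
  (j < q)%nat -> (1 <= (j * m) mod q)%nat ->
  (((q - j) * m) mod q = q - (j * m) mod q)%nat.
Proof.
  intros Hj H0.
  assert (H1 := Nat.div_mod (j * m) q ltac:(lia)).
  assert (H2 := Nat.mod_upper_bound (j * m) q ltac:(lia)).
  assert (E : ((q - j) * m = (q - (j * m) mod q) + (m - (j * m) / q - 1) * q)%nat).
  { assert (0 < m)%nat by (destruct m; [rewrite Nat.mul_0_r in H1, H0; nia|lia]).
    assert ((j * m) / q < m)%nat by (apply Nat.Div0.div_lt_upper_bound; nia). nia. }
  rewrite E, Nat.Div0.mod_add. apply Nat.mod_small. lia.
Qed.

(** For [reversed c n] and [i = t - 1], the terms are [H(c_(n-i)) / Q_i]. *)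
Definition denominator_weight (c : nat -> nat) (n : nat) : R :=
  sum1 (fun t => harmonic (c t) / INR (cf_den c (t - 1))) n.

(** After [cot_half], reflecting [j -> q - j] in the second piece and using
    [phi (q - j) = q - phi j] gives the coefficients [2 phi j - q] against the decreasing weight
    [cot (pi j / (2 q)) / 2 <= q / (pi j)]. The partial sums are bounded by cutting into blocks,
    each contributing at most [2 q]. *)
Lemma cot_sum_bound (c : nat -> nat) (n : nat) :
  positive_seq c -> (1 <= n)%nat ->
  Rabs (sum1 (fun j => INR ((j * cf_den c (n - 1)) mod cf_den c n)
                       * cot (PI * (INR j / INR (cf_den c n)))) (cf_den c n - 1))
  <= 2 * INR (cf_den c n) * (INR (cf_den c n) / PI) * denominator_weight (reversed c n) n.
Proof.
  intros Hc Hn.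
  assert (HPI := PI_RGT_0).
  set (q := cf_den c n). set (m := cf_den c (n - 1)).
  assert (Hq : (0 < q)%nat) by apply (cf_den_mono c n Hc).
  assert (HqR : 0 < INR q) by now apply lt_0_INR.
  assert (Hg : Z.gcd (Z.of_nat q) (Z.of_nat m) = 1%Z).
  { unfold q, m. replace n with (S (n - 1)) at 1 by lia. apply cf_den_coprime. }
  set (phi := fun j => ((j * m) mod q)%nat).
  set (w := fun j => / 2 * cot (PI * (INR j / INR q) / 2)).
  assert (Hj : forall j, (1 <= j <= q - 1)%nat -> 0 < PI * (INR j / INR q) < PI).
  { intros j H.
    assert (H1 := frac_bounds q j ltac:(lia)).
    assert (H2 := frac_lt_1 q j ltac:(lia)). nra. }
  rewrite (big_ext _ _ _ (fun j => INR (phi j) * w j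
     + (-1) * (INR (phi j) * w (q - j)%nat))).
  2:{ intros j H. rewrite cot_half by now apply Hj. fold (phi j). unfold w.
      rewrite minus_INR by lia.
      replace (PI * ((INR q - INR j) / INR q)) with (PI - PI * (INR j / INR q))
        by (field; lra). ring. }
  rewrite sum1_plus, sum1_scal.
  rewrite <- (sum1_reindex (fun j => q - j)%nat (fun j => INR (phi j) * w (q - j)%nat))
    by (intros; lia).
  rewrite <- sum1_scal, <- sum1_plus.
  rewrite (big_ext _ _ _ (fun j => (2 * INR (phi j) - INR q) * w j)).
  2:{ intros j H. replace (q - (q - j))%nat with j by lia.
      assert (Hr := coprime_mul_mod_range q m j Hg H).
      unfold phi. rewrite (mul_mod_opp q m j) by lia.
      rewrite minus_INR by lia. ring. }
  apply weighted_sum_bound.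
  - now apply reversed_positive.
  - lra.
  - apply Rlt_le, Rdiv_lt_0_compat; lra.
  - intros j H. specialize (Hj j H).
    assert (0 < INR j) by (apply lt_0_INR; lia).
    unfold w. split.
    + assert (0 <= cot (PI * (INR j / INR q) / 2)) by (apply cot_ge_0; lra). lra.
    + assert (Hle : cot (PI * (INR j / INR q) / 2) <= / (PI * (INR j / INR q) / 2))
        by (apply cot_le_inv; lra).
      replace (INR q / PI * / INR j) with (/ 2 * / (PI * (INR j / INR q) / 2))
        by (field; lra). lra.
  - intros j H. unfold w.
    assert (H1 := Hj j ltac:(lia)). assert (H2 := Hj (S j) ltac:(lia)).
    apply Rmult_le_compat_l; [lra|]. apply cot_decr; [lra| |lra].
    apply Rmult_le_compat_r; [lra|]. apply Rmult_le_compat_l; [lra|].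
    apply Rmult_le_compat_r; [now apply Rlt_le, Rinv_0_lt_compat|].
    apply le_INR; lia.
  - intros N HN.
    apply (greedy_sum_bound (fun j => 2 * INR (phi j) - INR q) (reversed c n) (2 * INR q) n)
      with (s := O).
    + now apply reversed_positive.
    + intros i s Hi. unfold phi.
      assert (Hk := cf_reversed_approx c n i (n - i - 1) ltac:(lia)).
      eapply (block_sum_bound q m _ (Z.of_nat (cf_num (reversed c n) i)) _ s Hq);
        [apply (cf_den_mono _ i), reversed_positive, Hc|apply cf_num_den_coprime|exact Hk|].
      assert (Habs : Z.abs ((-1) ^ Z.of_nat i * Z.of_nat (cf_den c (n - i - 1)))
        = Z.of_nat (cf_den c (n - i - 1))).
      { destruct (sign_cases i) as [E|E]; rewrite E; lia. }
      rewrite Habs.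
      (* The smallness condition on a block, [Q_i q_(n-i-1) <= q_n], comes from splitting the
         continuant. *)
      assert (Hle : (cf_den (reversed c n) i * cf_den c (n - i - 1) <= q)%nat); [|lia].
      destruct i as [|i].
      * cbn [cf_den]. rewrite Nat.sub_0_r, Nat.mul_1_l. apply cf_den_le; [easy|lia].
      * destruct (n - S i - 1)%nat as [|k] eqn:Ek.
        -- change (cf_den c 0) with 1%nat. rewrite Nat.mul_1_r. unfold q. rewrite <- (cf_den_reversed_full c n).
           apply cf_den_le; [now apply reversed_positive|lia].
        -- assert (H := cf_den_reversed c n i (S k) ltac:(lia)). fold q in H.
           assert (H' := cf_den_mono c (S k) Hc). nia.
    + rewrite cf_den_reversed_full. fold q. lia.
Qed.

(** * Perturbed sine products *)

Lemma sum_inv_sq (n : nat) : sum1 (fun j => / INR j * / INR j) n <= 2.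
Proof.
  cut (sum1 (fun j => / INR j * / INR j) (S n) <= 2 - / INR (S n)).
  { assert (0 < / INR (S n)) by (apply Rinv_0_lt_compat, lt_0_INR; lia).
    cbn [big]. assert (0 <= / INR (S n) * / INR (S n)) by nra. lra. }
  induction n as [|n IH]; [cbn; lra|].
  set (m := S n) in *. cbn [big].
  assert (Hm : 0 < INR m) by (apply lt_0_INR; lia).
  rewrite (S_INR m).
  assert (E : / INR m - / (INR m + 1) = / INR m * / (INR m + 1)) by (field; lra).
  assert (/ (INR m + 1) <= / INR m) by (apply Rinv_le_contravar; lra).
  assert (0 < / (INR m + 1)) by (apply Rinv_0_lt_compat; lra).
  nra.
Qed.

(** Since [sin y = 2 sin (y/2) cos (y/2)], the reciprocal square is a quarter of the sum of those of
    [sin (y/2)] and [cos (y/2)]. This separates the singularities at 0 and [pi]. *)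
Lemma inv_sin_sq_bound (y : R) :
  0 < y < PI -> / Rsqr (sin y) <= 4 * (/ Rsqr y + / Rsqr (PI - y)).
Proof.
  intros Hy.
  assert (Hs : y / 4 <= sin (y / 2)) by (assert (H := sin_ge_half (y / 2)); lra).
  assert (Hc : (PI - y) / 4 <= cos (y / 2)).
  { rewrite cos_sin. assert (H := sin_ge_half (PI / 2 - y / 2)).
    replace (sin (PI / 2 + y / 2)) with (sin (PI / 2 - y / 2)); [lra|].
    rewrite sin_plus, sin_minus, cos_PI2. ring. }
  set (a := sin (y / 2)) in *. set (b := cos (y / 2)) in *.
  assert (Ey : sin y = 2 * a * b).
  { unfold a, b. rewrite <- sin_2a. f_equal. field. }
  assert (Hab : a * a + b * b = 1) by apply (sin2_cos2 (y / 2)).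
  assert (E : / Rsqr (sin y) = / 4 * (/ (a * a) + / (b * b))).
  { rewrite Ey. unfold Rsqr.
    transitivity ((a * a + b * b) / (2 * a * b * (2 * a * b))).
    - rewrite Hab. field. lra.
    - field. lra. }
  rewrite E. unfold Rsqr.
  assert (H1 : / (a * a) <= / (y / 4 * (y / 4))).
  { apply Rinv_le_contravar; nra. }
  assert (H2 : / (b * b) <= / ((PI - y) / 4 * ((PI - y) / 4))).
  { apply Rinv_le_contravar; nra. }
  replace (/ (y / 4 * (y / 4))) with (16 * / (y * y)) in H1 by (field; lra).
  replace (/ ((PI - y) / 4 * ((PI - y) / 4))) with (16 * / ((PI - y) * (PI - y))) in H2
    by (field; lra).
  lra.
Qed.

Lemma abs_sin_le (x : R) : Rabs (sin x) <= Rabs x.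
Proof.
  destruct (Rtotal_order x 0) as [H|[H|H]].
  - rewrite <- (Ropp_involutive x), sin_neg, !Rabs_Ropp.
    rewrite (Rabs_left x) by lra. apply Rabs_le.
    assert (H1 := sin_lt_x (- x) ltac:(lra)).
    destruct (Rle_lt_dec (- x) PI) as [H2|H2].
    + assert (0 <= sin (- x)) by (apply sin_ge_0; lra). lra.
    + assert (H3 := SIN_bound (- x)). assert (HPI := PI2_3_2). lra.
  - subst. rewrite sin_0. lra.
  - rewrite (Rabs_pos_eq x) by lra. apply Rabs_le.
    assert (H1 := sin_lt_x x ltac:(lra)).
    destruct (Rle_lt_dec x PI) as [H2|H2].
    + assert (0 <= sin x) by (apply sin_ge_0; lra). lra.
    + assert (H3 := SIN_bound x). assert (HPI := PI2_3_2). lra.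
Qed.

(** The two bounds for [sin (y + v)] are multiplied over [y = pi j / q], [v = - pi D (phi j) / q].
    The lower one loses the product of the [1 - (sin v / sin y)^2], which is at least [1 - 1/25]. *)
Lemma perturbed_prod_bounds (q : nat) (phi : nat -> nat) (D : R) :
  (0 < q)%nat ->
  (forall j, (1 <= j <= q - 1)%nat -> (phi j <= q)%nat) ->
  0 <= D -> D * INR q <= / 23 ->
  let V := - (PI * D / INR q)
    * sum1 (fun j => INR (phi j) * cot (PI * (INR j / INR q))) (q - 1) in
  INR q * exp V / 2
  <= prod1 (fun j => 2 * sin (PI * ((INR j - INR (phi j) * D) / INR q))) (q - 1)
  <= INR q * exp V.
Proof.
  intros Hq Hphi HD0 HD V.
  assert (HPI := PI_RGT_0).
  assert (HqR : 0 < INR q) by now apply lt_0_INR.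
  set (y := fun j : nat => PI * (INR j / INR q)).
  set (v := fun j : nat => - (PI * D / INR q) * INR (phi j)).
  assert (Hv : forall j, (1 <= j <= q - 1)%nat -> 0 <= - v j <= PI / 23 * / INR q).
  { intros j Hj.
    assert (H1 : INR (phi j) <= INR q) by (apply le_INR, Hphi, Hj).
    assert (H2 : 0 <= INR (phi j)) by apply pos_INR.
    assert (H3 : 0 <= D * INR (phi j) <= / 23) by (split; [|eapply Rle_trans; [|exact HD]];
      [apply Rmult_le_pos; lra|apply Rmult_le_compat_l; lra]).
    replace (- v j) with (PI * (D * INR (phi j)) * / INR q) by (unfold v; field; lra).
    assert (Hi : 0 < / INR q) by now apply Rinv_0_lt_compat.
    split; [apply Rmult_le_pos; nra|apply Rmult_le_compat_r; nra]. }
  assert (Hy : forall j, (1 <= j <= q - 1)%nat ->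
    PI * / INR q <= y j /\ PI * / INR q <= PI - y j).
  { intros j Hj. unfold y.
    assert (H1 : 1 <= INR j) by (apply (le_INR 1); lia).
    assert (H2 : INR j + 1 <= INR q) by (rewrite <- S_INR; apply le_INR; lia).
    assert (Hi : 0 < / INR q) by now apply Rinv_0_lt_compat.
    replace (PI - PI * (INR j / INR q)) with (PI * ((INR q - INR j) * / INR q))
      by (field; lra).
    unfold Rdiv. split; apply Rmult_le_compat_l; nra. }
  assert (Hpos : forall j, (1 <= j <= q - 1)%nat ->
    0 < y j < PI /\ 0 < y j - v j < PI /\ 0 < y j + v j < PI /\ - PI <= v j <= PI).
  { intros j Hj. specialize (Hv j Hj). specialize (Hy j Hj).
    assert (Hi : 0 < / INR q) by now apply Rinv_0_lt_compat.
    assert (Hpq : 0 < PI * / INR q) by now apply Rmult_lt_0_compat.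
    assert (Hp1 : PI / 23 * / INR q = PI * / INR q / 23) by (field; lra).
    lra. }
  rewrite (big_ext _ _ _ (fun j => 2 * sin (y j + v j))).
  2:{ intros j _. do 2 f_equal. unfold y, v. field. lra. }
  assert (EV : V = sum1 (fun j => v j * cot (y j)) (q - 1)).
  { unfold V. rewrite <- sum1_scal. apply big_ext. intros j _. unfold v, y. ring. }
  assert (Hexact : INR q = prod1 (fun j => 2 * sin (y j)) (q - 1)).
  { assert (H := prod_sin (q - 1)). replace (S (q - 1)) with q in H by lia.
    now rewrite <- H at 1. }
  assert (Hs : forall j, (1 <= j <= q - 1)%nat -> 0 < sin (y j)).
  { intros j Hj. apply sin_gt_0; apply (Hpos j Hj). }
  rewrite EV, <- prod1_exp. rewrite Hexact at 1.
  assert (Hup : prod1 (fun j => 2 * sin (y j)) (q - 1)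
    * prod1 (fun j => exp (v j * cot (y j))) (q - 1) =
    prod1 (fun j => 2 * (sin (y j) * exp (v j * cot (y j)))) (q - 1)).
  { rewrite <- prod1_mult. apply big_ext. intros; ring. }
  split.
  2:{ rewrite Hexact, Hup. apply prod1_le. intros j Hj.
      destruct (Hpos j Hj) as (P1 & P2 & P3 & P4).
      assert (0 < sin (y j + v j)) by (apply sin_gt_0; lra).
      assert (Hle := sin_shift_le (y j) (v j) P1 P4). lra. }
  set (x := fun j => Rsqr (sin (v j) / sin (y j))).
  (* As [|v j| <= pi / (23 q)], the constant obtained is [4 / 529 < 1 / 100]. *)
  assert (Hx : forall j, (1 <= j <= q - 1)%nat -> 0 <= x j <=
    / 100 * (/ INR j * / INR j + / INR (q - j) * / INR (q - j))).
  { intros j Hj. split; [apply Rle_0_sqr|].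
    specialize (Hv j Hj). destruct (Hpos j Hj) as (P1 & P2 & P3 & P4).
    specialize (Hs j Hj).
    assert (Hjp : 0 < INR j) by (apply lt_0_INR; lia).
    assert (Hjq : 0 < INR q - INR j) by (apply Rlt_0_minus, lt_INR; lia).
    unfold x. rewrite Rsqr_div', minus_INR by lia.
    assert (H1 : Rsqr (sin (v j)) <= Rsqr (PI / 23 * / INR q)).
    { apply Rsqr_le_abs_1. eapply Rle_trans; [apply abs_sin_le|].
      rewrite <- Rabs_Ropp. rewrite !Rabs_pos_eq; lra. }
    assert (H2 := inv_sin_sq_bound (y j) P1).
    assert (H3 : 0 < / Rsqr (sin (y j))) by (apply Rinv_0_lt_compat, Rsqr_pos_lt; lra).
    assert (H4 := Rle_0_sqr (sin (v j))).
    apply Rle_trans with (Rsqr (PI / 23 * / INR q)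
      * (4 * (/ Rsqr (y j) + / Rsqr (PI - y j)))).
    - apply Rmult_le_compat; lra.
    - replace (Rsqr (PI / 23 * / INR q) * (4 * (/ Rsqr (y j) + / Rsqr (PI - y j))))
        with (4 / 529 * (/ INR j * / INR j + / (INR q - INR j) * / (INR q - INR j))).
      + apply Rmult_le_compat_r; [|lra].
        apply Rplus_le_le_0_compat; apply Rle_0_sqr.
      + unfold y, Rsqr. field. repeat split; try lra.
        replace (PI * INR q - PI * INR j) with (PI * (INR q - INR j)) by ring.
        apply Rmult_integral_contrapositive; lra. }
  (* Each of the two sums of inverse squares is at most 2. *)
  assert (Hsum : sum1 x (q - 1) <= / 25).
  { eapply Rle_trans; [apply sum1_le; intros j Hj; apply (Hx j Hj)|].
    rewrite sum1_scal, sum1_plus.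
    rewrite (sum1_reindex (fun j => q - j)%nat (fun j => / INR j * / INR j))
      by (intros; lia).
    assert (H := sum_inv_sq (q - 1)). lra. }
  assert (Hx1 : forall j, (1 <= j <= q - 1)%nat -> 0 <= x j <= 1).
  { intros j Hj. specialize (Hx j Hj). split; [lra|].
    eapply Rle_trans; [apply Hx|].
    assert (A1 : 0 < / INR j <= 1).
    { split; [apply Rinv_0_lt_compat, lt_0_INR; lia|].
      rewrite <- Rinv_1. apply Rinv_le_contravar; [lra|apply (le_INR 1); lia]. }
    assert (A2 : 0 < / INR (q - j) <= 1).
    { split; [apply Rinv_0_lt_compat, lt_0_INR; lia|].
      rewrite <- Rinv_1. apply Rinv_le_contravar; [lra|apply (le_INR 1); lia]. }
    nra. }
  assert (Hw := prod1_one_minus x (q - 1) Hx1).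
  rewrite Hup.
  assert (HU : 0 <= prod1 (fun j => 2 * (sin (y j) * exp (v j * cot (y j)))) (q - 1)).
  { apply prod1_ge_0. intros j Hj. specialize (Hs j Hj).
    assert (H := exp_pos (v j * cot (y j))). nra. }
  apply Rle_trans with (prod1 (fun j => 2 * (sin (y j) * exp (v j * cot (y j)))) (q - 1)
    * prod1 (fun j => 1 - x j) (q - 1)).
  - apply Rmult_le_compat_l; lra.
  - rewrite <- prod1_mult. apply prod1_le. intros j Hj.
    destruct (Hpos j Hj) as (P1 & P2 & P3 & P4). specialize (Hs j Hj).
    specialize (Hx1 j Hj).
    assert (H := exp_pos (v j * cot (y j))).
    assert (Hl := sin_shift_ge (y j) (v j) P1 P2 (proj1 P3) (proj2 Hx1)).
    fold (x j) in Hl. split; [|lra].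
    apply Rmult_le_pos; [nra|lra].
Qed.

Lemma abs_sin_add_IZR (k : Z) (x : R) :
  Rabs (sin (PI * (IZR k + x))) = Rabs (sin (PI * x)).
Proof.
  assert (Hs : sin (IZR k * PI) = 0) by (apply sin_eq_0_1; now exists k).
  assert (Hc : Rabs (cos (IZR k * PI)) = 1).
  { rewrite <- Rabs_R1. apply Rsqr_eq_abs_0.
    assert (H := sin2_cos2 (IZR k * PI)). rewrite Hs in H. unfold Rsqr in *. lra. }
  replace (PI * (IZR k + x)) with (IZR k * PI + PI * x) by ring.
  rewrite sin_plus, Hs, Rmult_0_l, Rplus_0_l, Rabs_mult, Hc. ring.
Qed.

(** The substitution [r = j q_(n-1) mod q_n] permutes the factors. By the determinant identity
    [r p_n] is congruent to [j] up to sign modulo [q_n], so [r beta] is, up to sign and an integer,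
    [(j - r E) / q_n]. This lies in [(0, 1)], where the sine needs no absolute value. *)
Lemma sudler_reindex (c : nat -> nat) (n : nat) (beta E : R) :
  positive_seq c -> (1 <= n)%nat ->
  0 <= E -> INR (cf_den c n) * E <= 1 ->
  INR (cf_den c n) * beta = INR (cf_num c n) + IZR ((-1) ^ Z.of_nat n) * E ->
  sudler beta (cf_den c n - 1)
  = prod1 (fun j => 2 * sin (PI * ((INR j
        - INR ((j * cf_den c (n - 1)) mod cf_den c n) * E) / INR (cf_den c n))))
      (cf_den c n - 1).
Proof.
  intros Hc Hn HE0 HE Hbeta.
  assert (HPI := PI_RGT_0).
  assert (Hdet := cf_det c (n - 1)).
  assert (Hg := cf_den_coprime c (n - 1)).
  replace (S (n - 1)) with n in Hdet, Hg by lia.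
  replace ((-1) ^ Z.of_nat n)%Z with (- (-1) ^ Z.of_nat (n - 1))%Z in Hbeta.
  2:{ replace n with (S (n - 1)) at 2 by lia.
      rewrite Nat2Z.inj_succ, Z.pow_succ_r by lia. ring. }
  rewrite <- Hdet in Hbeta.
  assert (Hsg := sign_cases (n - 1)).
  set (q := cf_den c n) in *. set (m := cf_den c (n - 1)) in *.
  set (p := cf_num c n) in *. set (p' := cf_num c (n - 1)) in *.
  set (sg := (Z.of_nat q * Z.of_nat p' - Z.of_nat m * Z.of_nat p)%Z) in *.
  assert (HsgR : IZR sg = INR q * INR p' - INR m * INR p).
  { unfold sg. now rewrite minus_IZR, !mult_IZR, <- !INR_IZR_INZ. }
  assert (Hq : (0 < q)%nat) by apply (cf_den_mono c n Hc).
  assert (HqR : 0 < INR q) by now apply lt_0_INR.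
  rewrite sudler_prod1.
  rewrite <- (prod1_reindex (fun j => ((j * m) mod q)%nat)).
  2:{ intros j Hj. now apply coprime_mul_mod_range. }
  2:{ intros i j Hi Hj. apply coprime_mul_mod_inj; [easy|lia|lia]. }
  apply big_ext. intros j Hj.
  assert (Hdm := Nat.div_mod (j * m) q ltac:(lia)).
  assert (Hr := Nat.mod_upper_bound (j * m) q ltac:(lia)).
  set (f := ((j * m) mod q)%nat) in *. set (k := ((j * m) / q)%nat) in *.
  apply (f_equal INR) in Hdm. rewrite plus_INR, !mult_INR in Hdm.
  set (y := (INR j - INR f * E) / INR q).
  assert (Hy : 0 < y < 1).
  { unfold y.
    assert (H1 : 1 <= INR j) by (apply (le_INR 1); lia).
    assert (H2 : INR j + 1 <= INR q) by (rewrite <- S_INR; apply le_INR; lia).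
    assert (H3 : INR f + 1 <= INR q) by (rewrite <- S_INR; apply le_INR; lia).
    assert (H4 : 0 <= INR f) by apply pos_INR.
    assert (H5 : 0 <= INR f * E < 1).
    { split; [apply Rmult_le_pos; lra|].
      destruct (Req_dec E 0) as [->|H]; nra. }
    split; [apply Rdiv_lt_0_compat; lra|apply Rlt_div_l; lra]. }
  assert (Eq : INR f * beta = IZR (Z.of_nat j * Z.of_nat p' - Z.of_nat k * Z.of_nat p)
    + (- IZR sg) * y).
  { rewrite minus_IZR, !mult_IZR, <- !INR_IZR_INZ.
    unfold y. apply Rmult_eq_reg_l with (INR q); [|lra].
    replace (INR q * (INR f * beta)) with (INR f * (INR q * beta)) by ring.
    rewrite Hbeta.
    replace (INR q * (INR j * INR p' - INR k * INR p + - IZR sg * ((INR j - INR f * E) / INR q)))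
      with (INR q * (INR j * INR p' - INR k * INR p) - IZR sg * INR j + IZR sg * (INR f * E))
      by (field; lra).
    assert (Ef : INR f = INR j * INR m - INR q * INR k) by lra.
    rewrite HsgR, Ef. ring. }
  rewrite Rmult_assoc, Eq, Rabs_mult, abs_sin_add_IZR.
  rewrite (Rabs_pos_eq 2) by lra. f_equal.
  assert (Hsin : 0 < sin (PI * y)) by (apply sin_gt_0; nra).
  assert (Hcase : PI * (- IZR sg * y) = PI * y \/ PI * (- IZR sg * y) = - (PI * y)).
  { rewrite Hdet. destruct Hsg as [H|H]; rewrite H; cbn [Z.opp]; [left|right]; ring. }
  destruct Hcase as [H|H]; rewrite H, ?sin_neg, ?Rabs_Ropp; apply Rabs_pos_eq; lra.
Qed.

(** * Sudler products at convergent denominators *)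

(** Fibonacci growth from [q_2 >= 2] and [q_3 >= 3], since [(3/2)^2 <= 3/2 + 1]. *)
Lemma cf_den_ge_geometric (c : nat -> nat) (n : nat) :
  positive_seq c -> 2 * (3 / 2) ^ n <= INR (cf_den c (n + 2)).
Proof.
  intros Hc.
  assert (Hrec : forall m, INR (cf_den c (S m)) + INR (cf_den c m) <= INR (cf_den c (S (S m)))).
  { intros m. rewrite <- plus_INR. apply le_INR. rewrite cf_den_SS.
    assert (H := Hc (S (S m))). nia. }
  assert (H0 := Hrec 0%nat). assert (H1 := Hrec 1%nat).
  change (cf_den c 1) with (c 1%nat) in H0, H1. change (INR (cf_den c 0)) with 1 in H0.
  assert (Hc1 : 1 <= INR (c 1%nat)) by (apply (le_INR 1), Hc; lia).
  cut (2 * (3 / 2) ^ n <= INR (cf_den c (n + 2)) /\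
       2 * (3 / 2) ^ S n <= INR (cf_den c (S n + 2))); [tauto|].
  induction n as [|n [IH1 IH2]].
  - cbn [Nat.add pow]. split; lra.
  - split; [exact IH2|]. specialize (Hrec (n + 2)%nat).
    change (S (n + 2)) with (S n + 2)%nat in Hrec.
    change (S (S n + 2)) with (S (S n) + 2)%nat in Hrec.
    assert (0 < (3 / 2) ^ n) by (apply pow_lt; lra).
    cbn [pow] in *. lra.
Qed.

(** The first two terms are at most 1 each, and the others are dominated by a geometric series with
    sum [(1/2) * 3]. *)
Lemma sum_inv_cf_den (c : nat -> nat) (k : nat) :
  positive_seq c -> sum1 (fun t => / INR (cf_den c (t - 1))) k <= 7 / 2.
Proof.
  intros Hc.
  assert (Hpos : forall j, 0 < / INR (cf_den c j)).
  { intros j. apply Rinv_0_lt_compat, lt_0_INR, (cf_den_mono c j Hc). }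
  cut (sum1 (fun t => / INR (cf_den c (t - 1))) (S (S k)) <= 7 / 2 - 3 / 2 * (2 / 3) ^ k).
  { cbn [big]. assert (H1 := Hpos (S k - 1)%nat). assert (H2 := Hpos (S (S k) - 1)%nat).
    assert (0 < (2 / 3) ^ k) by (apply pow_lt; lra). lra. }
  induction k as [|k IH].
  - cbn [big Nat.sub cf_den INR pow].
    assert (1 <= INR (c 1%nat)) by (apply (le_INR 1), Hc; lia).
    assert (/ INR (c 1%nat) <= 1) by (rewrite <- Rinv_1; apply Rinv_le_contravar; lra).
    lra.
  - set (m := S (S k)) in *. cbn [big]. replace (S m - 1)%nat with (k + 2)%nat by lia.
    assert (H := cf_den_ge_geometric c k Hc).
    assert (H1 : 0 < (3 / 2) ^ k) by (apply pow_lt; lra).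
    assert (H2 : (2 / 3) ^ k = / (3 / 2) ^ k).
    { rewrite <- pow_inv. f_equal. field. }
    assert (H3 : / INR (cf_den c (k + 2)) <= / (2 * (3 / 2) ^ k)).
    { apply Rinv_le_contravar; lra. }
    rewrite Rinv_mult, <- H2 in H3. cbn [pow]. lra.
Qed.

(** Reversal puts the preperiod last, where the denominators are at least [k], so its contribution
    vanishes as [k] grows. *)
Lemma denominator_weight_bound (c : nat -> nat) (h k A B : nat) :
  positive_seq c -> (1 <= k)%nat ->
  (forall j, (h < j)%nat -> (c j <= A)%nat) ->
  (forall j, (1 <= j <= h)%nat -> (c j <= B)%nat) ->
  denominator_weight (reversed c (k + h)) (k + h)
  <= harmonic A * (7 / 2) + harmonic B * INR h / INR k.
Proof.
  intros Hc Hk HA HB.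
  assert (Hc' := reversed_positive c (k + h) Hc).
  assert (Hpos : forall j, 0 < / INR (cf_den (reversed c (k + h)) j)).
  { intros j. apply Rinv_0_lt_compat, lt_0_INR, (cf_den_mono _ j Hc'). }
  unfold denominator_weight. rewrite sum1_app. apply Rplus_le_compat.
  - apply Rle_trans with (harmonic A *
      sum1 (fun t => / INR (cf_den (reversed c (k + h)) (t - 1))) k).
    + rewrite <- sum1_scal. apply sum1_le. intros t Ht.
      apply Rmult_le_compat_r; [apply Rlt_le, Hpos|].
      apply harmonic_mono, HA. lia.
    + apply Rmult_le_compat_l; [apply harmonic_ge_0|now apply sum_inv_cf_den].
  - apply Rle_trans with (sum1 (fun _ => harmonic B / INR k) h).
    + apply sum1_le. intros t Ht.
      assert (0 < INR k) by (apply lt_0_INR; lia).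
      apply Rmult_le_compat; [apply harmonic_ge_0|apply Rlt_le, Hpos| |].
      * apply harmonic_mono, HB. lia.
      * apply Rinv_le_contravar; [easy|]. apply le_INR.
        apply Nat.le_trans with (cf_den (reversed c (k + h)) k);
          [now apply cf_den_ge|apply cf_den_le; [easy|lia]].
    + rewrite sum1_const. apply Req_le. field. apply not_0_INR; lia.
Qed.

Lemma bounded_prefix (c : nat -> nat) (h : nat) :
  exists B, forall j, (1 <= j <= h)%nat -> (c j <= B)%nat.
Proof.
  induction h as [|h [B HB]]; [exists O; lia|].
  exists (Nat.max B (c (S h))). intros j Hj.
  destruct (Nat.eq_dec j (S h)) as [->|H]; [lia|].
  specialize (HB j ltac:(lia)). lia.
Qed.

(** The constant lies just above [H(23) / 23], about 0.16236, and later increments are at most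
    [1 / 24]. *)
Lemma harmonic_le_linear (A : nat) :
  (23 <= A)%nat -> harmonic A <= 1624 / 10000 * INR A.
Proof.
  induction 1 as [|A HA IH].
  - unfold harmonic. cbn [big]. rewrite !INR_IZR_INZ. cbn. lra.
  - unfold harmonic in *. cbn [big]. rewrite S_INR in *.
    assert (H : 23 <= INR A).
    { replace 23 with (INR 23) by (rewrite INR_IZR_INZ; reflexivity). now apply le_INR. }
    assert (/ (INR A + 1) <= / 24) by (apply Rinv_le_contravar; lra).
    lra.
Qed.

(** The 24th power of [exp (1 / 20) <= 1 / (1 - 1 / 20)]. *)
Lemma exp_6_5 : exp (6 / 5) <= (20 / 19) ^ 24.
Proof.
  assert (H := exp_ineq1_le (- (1 / 20))).
  assert (Hp := exp_pos (1 / 20)).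
  assert (H1 : exp (1 / 20) <= 20 / 19).
  { rewrite exp_Ropp in H.
    assert (E : / exp (1 / 20) * exp (1 / 20) = 1) by (apply Rinv_l; lra). nra. }
  assert (E : forall n, exp (INR n * (1 / 20)) = exp (1 / 20) ^ n).
  { induction n as [|n IH]; [cbn; now rewrite Rmult_0_l, exp_0|].
    rewrite S_INR, Rmult_plus_distr_r, exp_plus, IH, Rmult_1_l. cbn. ring. }
  replace (6 / 5) with (INR 24 * (1 / 20)) by (rewrite INR_IZR_INZ; cbn; field).
  rewrite E. apply pow_incr. lra.
Qed.

(** * Tails of the continued fraction and approximation errors *)

Lemma convergent_from_bounds (c : nat -> nat) (i n : nat) :
  positive_seq c -> (1 <= i)%nat -> 0 <= convergent_from c i n <= 1.
Proof.
  intros Hc. revert i; induction n as [|n IH]; intros i Hi; cbn; [lra|].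
  assert (H := IH (S i) ltac:(lia)).
  assert (1 <= INR (c i)) by (apply (le_INR 1), Hc, Hi).
  split; [apply Rlt_le, Rinv_0_lt_compat; lra|].
  rewrite <- Rinv_1. apply Rinv_le_contravar; lra.
Qed.

(** The approximants stay above [1 / (c_i + 1)], so the limit is positive and taking reciprocals
    passes to the limit. *)
Lemma cfrac_tail (c : nat -> nat) (i : nat) (x : R) :
  positive_seq c -> (1 <= i)%nat -> is_lim_seq (fun n => convergent_from c i n) x ->
  0 < x /\ is_lim_seq (fun n => convergent_from c (S i) n) (/ x - INR (c i)).
Proof.
  intros Hc Hi Hx.
  assert (Hci : 1 <= INR (c i)) by (apply (le_INR 1), Hc, Hi).
  apply is_lim_seq_incr_1 in Hx.
  assert (Hx0 : 0 < x).
  { apply Rlt_le_trans with (/ (INR (c i) + 1)); [apply Rinv_0_lt_compat; lra|].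
    apply (is_lim_seq_le (fun _ => / (INR (c i) + 1)) (fun n => convergent_from c i (S n))
      (Finite (/ (INR (c i) + 1))) (Finite x)).
    - intros n. cbn. assert (H := convergent_from_bounds c (S i) n Hc ltac:(lia)).
      apply Rinv_le_contravar; lra.
    - apply is_lim_seq_const.
    - exact Hx. }
  split; [easy|].
  apply is_lim_seq_ext with (fun n => / convergent_from c i (S n) - INR (c i)).
  - intros n. cbn. rewrite Rinv_inv. ring.
  - apply is_lim_seq_minus'; [|apply is_lim_seq_const].
    apply (is_lim_seq_inv _ (Finite x) Hx). intros E. injection E. lra.
Qed.

(** Iterates of the Gauss map with prescribed quotients; for [beta] with expansion [c] these are
    [[0; c_(n+1), c_(n+2), ...]]. *)
Fixpoint cf_tail (c : nat -> nat) (beta : R) (n : nat) : R :=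
  match n with
  | O => beta
  | S m => / cf_tail c beta m - INR (c (S m))
  end.

Lemma cf_tail_pos (c : nat -> nat) (beta : R) (n : nat) :
  positive_seq c -> is_cfrac c beta -> 0 < cf_tail c beta n.
Proof.
  intros Hc Hb.
  cut (is_lim_seq (fun m => convergent_from c (S n) m) (cf_tail c beta n)).
  { intros H. apply (cfrac_tail c (S n) _ Hc ltac:(lia) H). }
  induction n as [|n IH]; [exact Hb|].
  now apply cfrac_tail in IH; [|easy|lia].
Qed.

(** Convergents lie alternately on the two sides of [beta]; the sign makes this
    [|q_n beta - p_n|]. *)
Definition cf_error (c : nat -> nat) (beta : R) (n : nat) : R :=
  IZR ((-1) ^ Z.of_nat n) * (INR (cf_den c n) * beta - INR (cf_num c n)).

(** Both sides satisfy [E_(n+2) = E_n - c_(n+2) E_(n+1)]. Positivity of the tails thereby passes to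
    the errors. *)
Lemma cf_error_step (c : nat -> nat) (beta : R) (n : nat) :
  positive_seq c -> is_cfrac c beta ->
  cf_error c beta (S n) = cf_tail c beta (S n) * cf_error c beta n.
Proof.
  intros Hc Hb.
  induction n as [|n IH].
  - assert (H := cf_tail_pos c beta 0 Hc Hb). unfold cf_error. cbn in *. field. lra.
  - assert (H := cf_tail_pos c beta (S n) Hc Hb).
    change (cf_tail c beta (S (S n)))
      with (/ cf_tail c beta (S n) - INR (c (S (S n)))).
    set (t := cf_tail c beta (S n)) in *.
    assert (E : cf_error c beta n = / t * cf_error c beta (S n)).
    { rewrite IH. field. lra. }
    rewrite Rmult_minus_distr_r, <- E. unfold cf_error.
    rewrite cf_den_SS, cf_num_SS, !plus_INR, !mult_INR.
    rewrite !Nat2Z.inj_succ, !Z.pow_succ_r, !mult_IZR by lia. ring.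
Qed.

Lemma cf_error_pos (c : nat -> nat) (beta : R) (n : nat) :
  positive_seq c -> is_cfrac c beta -> 0 < cf_error c beta n.
Proof.
  intros Hc Hb. induction n as [|n IH].
  - assert (H := cf_tail_pos c beta 0 Hc Hb). unfold cf_error. cbn in *. lra.
  - rewrite cf_error_step by easy. apply Rmult_lt_0_compat; [now apply cf_tail_pos|easy].
Qed.

Lemma IZR_sign_sqr (n : nat) : IZR ((-1) ^ Z.of_nat n) * IZR ((-1) ^ Z.of_nat n) = 1.
Proof. destruct (sign_cases n) as [H|H]; rewrite H; ring. Qed.

Lemma cf_error_eq (c : nat -> nat) (beta : R) (n : nat) :
  INR (cf_den c n) * beta
  = INR (cf_num c n) + IZR ((-1) ^ Z.of_nat n) * cf_error c beta n.
Proof.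
  unfold cf_error. rewrite <- Rmult_assoc, IZR_sign_sqr. ring.
Qed.

(** The determinant identity gives [q_(n+1) E_n + q_n E_(n+1) = 1], with both terms nonnegative. *)
Lemma cf_error_le (c : nat -> nat) (beta : R) (n : nat) :
  positive_seq c -> is_cfrac c beta -> INR (cf_den c (S n)) * cf_error c beta n <= 1.
Proof.
  intros Hc Hb.
  assert (E : INR (cf_den c (S n)) * cf_error c beta n
    + INR (cf_den c n) * cf_error c beta (S n) = 1).
  { unfold cf_error. rewrite Nat2Z.inj_succ, Z.pow_succ_r, mult_IZR by lia.
    assert (H := f_equal IZR (cf_det c n)).
    rewrite minus_IZR, !mult_IZR, opp_IZR, <- !INR_IZR_INZ in H.
    assert (H1 := IZR_sign_sqr n).
    set (s := IZR ((-1) ^ Z.of_nat n)) in *.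
    transitivity (- s * (INR (cf_den c (S n)) * INR (cf_num c n)
      - INR (cf_den c n) * INR (cf_num c (S n)))); [ring|]. rewrite H. lra. }
  assert (H := cf_error_pos c beta (S n) Hc Hb).
  assert (H1 := pos_INR (cf_den c n)).
  assert (0 <= INR (cf_den c n) * cf_error c beta (S n)) by (apply Rmult_le_pos; lra).
  lra.
Qed.

Lemma sudler_ge_0 (beta : R) (N : nat) : 0 <= sudler beta N.
Proof. rewrite sudler_prod1. apply prod1_ge_0. intros. apply Rabs_pos. Qed.

(** The cotangent bound gives [|V| <= 6/5], hence the lower bound for [P_(q-1)]. In [P_q] the extra
    factor is at most [2 pi E], with [E q <= 1 / A]. The summand [1/2] leaves room for the
    preperiod. *)
Lemma sudler_at_denominator (c : nat -> nat) (beta : R) (n A : nat) :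
  positive_seq c -> is_cfrac c beta -> (1 <= n)%nat -> (23 <= A)%nat ->
  (A <= c (S n))%nat ->
  denominator_weight (reversed c n) n <= harmonic A * (7 / 2) + / 2 ->
  sudler beta (cf_den c n) <= 24 / 25 /\
  exp (- (6 / 5)) / 2 * INR (cf_den c n) <= sudler beta (cf_den c n - 1).
Proof.
  intros Hc Hb Hn HA HcA HW.
  assert (HPI := PI_RGT_0). assert (HPI3 := PI_lt_3_2).
  assert (HE := cf_error_pos c beta n Hc Hb).
  assert (HE1 := cf_error_le c beta n Hc Hb).
  assert (Heq := cf_error_eq c beta n).
  assert (Hq : (0 < cf_den c n)%nat) by apply (cf_den_mono c n Hc).
  assert (Hstep := cf_den_step_ge c n).
  set (q := cf_den c n) in *. set (E := cf_error c beta n) in *.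
  assert (HqR : 0 < INR q) by now apply lt_0_INR.
  assert (HAR : 23 <= INR A).
  { replace 23 with (INR 23) by (rewrite INR_IZR_INZ; reflexivity). now apply le_INR. }
  assert (HEq : E * INR q <= / INR A).
  { apply Rmult_le_reg_l with (INR A); [lra|]. rewrite Rinv_r by lra.
    eapply Rle_trans; [|exact HE1]. rewrite (Rmult_comm E), <- Rmult_assoc, <- mult_INR.
    apply Rmult_le_compat_r; [lra|]. apply le_INR. nia. }
  assert (HA23 : / INR A <= / 23) by (apply Rinv_le_contravar; lra).
  assert (Hpert := perturbed_prod_bounds q
    (fun j => (j * cf_den c (n - 1)) mod q)%nat E Hq).
  cbv beta zeta in Hpert.
  assert (Hcot := cot_sum_bound c n Hc Hn). fold q in Hcot.
  assert (Hre := sudler_reindex c n beta E Hc Hn).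
  fold q in Hre. rewrite <- Hre in Hpert by (lra || exact Heq).
  set (S := sum1 (fun j => INR ((j * cf_den c (n - 1)) mod q)
    * cot (PI * (INR j / INR q))) (q - 1)) in *.
  set (V := - (PI * E / INR q) * S) in *.
  assert (HV : - (6 / 5) <= V <= 6 / 5).
  { apply Rabs_le_between. unfold V.
    rewrite Rabs_mult, Rabs_Ropp, (Rabs_pos_eq (PI * E / INR q)).
    2:{ apply Rlt_le, Rdiv_lt_0_compat; [nra|easy]. }
    apply Rle_trans with (PI * E / INR q *
      (2 * INR q * (INR q / PI) * (harmonic A * (7 / 2) + / 2))).
    - apply Rmult_le_compat_l; [apply Rlt_le, Rdiv_lt_0_compat; [nra|easy]|].
      eapply Rle_trans; [exact Hcot|]. apply Rmult_le_compat_l; [|exact HW].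
      apply Rmult_le_pos; [lra|]. apply Rlt_le, Rdiv_lt_0_compat; lra.
    - replace (PI * E / INR q * (2 * INR q * (INR q / PI) * (harmonic A * (7 / 2) + / 2)))
        with (E * INR q * (7 * harmonic A + 1)) by (field; lra).
      assert (HH := harmonic_le_linear A HA). assert (HH0 := harmonic_ge_0 A).
      (* The result is [1.1368 + 1 / A], and [1 / A <= 1 / 23] leaves it below [6/5]. *)
      apply Rle_trans with (/ INR A * (7 * (1624 / 10000 * INR A) + 1)).
      + apply Rmult_le_compat; [nra|lra|exact HEq|lra].
      + replace (/ INR A * (7 * (1624 / 10000 * INR A) + 1))
          with (11368 / 10000 + / INR A) by (field; lra). lra. }
  assert (Hpert' : INR q * exp V / 2 <= sudler beta (q - 1) <= INR q * exp V).
  { apply Hpert; [|lra|lra].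
    intros j _. apply Nat.lt_le_incl, Nat.mod_upper_bound. lia. }
  assert (HexpV : exp (- (6 / 5)) <= exp V <= exp (6 / 5)).
  { assert (Hmono : forall x y, x <= y -> exp x <= exp y).
    { intros x y [H|H]; [now apply Rlt_le, exp_increasing|rewrite H; lra]. }
    split; apply Hmono; lra. }
  split.
  - replace q with (Datatypes.S (q - 1)) at 1 by lia. cbn [sudler].
    replace (Datatypes.S (q - 1)) with q by lia.
    assert (Hs : Rabs (2 * sin (PI * INR q * beta)) <= 2 * (PI * E)).
    { rewrite Rmult_assoc, Heq, Rabs_mult, (Rabs_pos_eq 2) by lra.
      rewrite INR_IZR_INZ, abs_sin_add_IZR. apply Rmult_le_compat_l; [lra|].
      eapply Rle_trans; [apply abs_sin_le|].
      rewrite !Rabs_mult, (Rabs_pos_eq PI), (Rabs_pos_eq E) by lra.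
      apply Rmult_le_compat_l; [lra|].
      destruct (sign_cases n) as [H|H]; rewrite H.
      - rewrite Rabs_R1; lra.
      - rewrite (Rabs_left (-1)) by lra. lra. }
    apply Rle_trans with (INR q * exp (6 / 5) * (2 * (PI * E))).
    + apply Rmult_le_compat; [apply sudler_ge_0|apply Rabs_pos| |exact Hs].
      eapply Rle_trans; [apply Hpert'|]. apply Rmult_le_compat_l; lra.
    + assert (H6 := exp_6_5). assert (H6' := exp_pos (6 / 5)).
      replace (INR q * exp (6 / 5) * (2 * (PI * E)))
        with (exp (6 / 5) * (PI * (2 * (E * INR q)))) by ring.
      (* The numerical margin is thin: this constant is about 0.953, against 0.96. *)
      apply Rle_trans with ((20 / 19) ^ 24 * (16 / 5 * (2 * / 23))); [|lra].
      assert (0 <= E * INR q) by nra.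
      apply Rmult_le_compat; [lra| |lra|]; [apply Rmult_le_pos; lra|].
      apply Rmult_le_compat; lra.
  - eapply Rle_trans; [|apply Hpert'].
    assert (INR q * exp (- (6 / 5)) <= INR q * exp V) by (apply Rmult_le_compat_l; lra).
    lra.
Qed.

(** * The limits *)

Lemma sudler_perturb (beta eta : R) (N : nat) :
  0 < eta -> exists d, 0 < d /\ forall x, Rabs x < d ->
  prod1 (fun r => Rabs (2 * sin (PI * (INR r * beta + x)))) N <= sudler beta N + eta.
Proof.
  intros Heta.
  set (F := fun x => prod1 (fun r => Rabs (2 * sin (PI * (INR r * beta + x)))) N).
  assert (Hc : continuous F 0).
  { unfold F. clear. induction N as [|N IH]; cbn [big].
    - apply continuous_const.
    - apply (continuous_mult (K := R_AbsRing)
        (fun x => prod1 (fun r => Rabs (2 * sin (PI * (INR r * beta + x)))) N)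
        (fun x => Rabs (2 * sin (PI * (INR (S N) * beta + x))))); [exact IH|].
      apply (continuous_comp (fun x => 2 * sin (PI * (INR (S N) * beta + x))) Rabs);
        [|apply continuous_Rabs].
      apply (ex_derive_continuous (V := R_NormedModule)). auto_derive. easy. }
  assert (HF0 : F 0 = sudler beta N).
  { rewrite sudler_prod1. apply big_ext. intros r _. do 3 f_equal. ring. }
  assert (Hcl := proj1 (filterlim_locally F (F 0)) Hc (mkposreal eta Heta)).
  destruct Hcl as [d Hd].
  exists d. split; [apply cond_pos|]. intros x Hx.
  assert (Hb : ball (F 0) eta (F x)).
  { apply Hd. change (Rabs (x - 0) < d). now rewrite Rminus_0_r. }
  change (Rabs (F x - F 0) < eta) in Hb. apply Rabs_lt_between in Hb.
  fold (F x). lra.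
Qed.

Lemma sudler_add (beta x : R) (p : Z) (q N : nat) :
  INR q * beta = IZR p + x ->
  sudler beta (q + N)
  = sudler beta q * prod1 (fun r => Rabs (2 * sin (PI * (INR r * beta + x)))) N.
Proof.
  intros Hq. rewrite !sudler_prod1, prod1_app. f_equal.
  apply big_ext. intros r _. rewrite !Rabs_mult. f_equal.
  rewrite Rmult_assoc, plus_INR, Rmult_plus_distr_r, Hq.
  rewrite <- (abs_sin_add_IZR p (INR r * beta + x)). do 3 f_equal. ring.
Qed.

(** The last [L] factors are listed from the top. Modulo 1, [(q - r) beta] is [- (r beta - x)], and
    sine is odd. *)
Lemma sudler_reflect (beta x : R) (p : Z) (q L : nat) :
  INR q * beta = IZR p + x -> (L < q)%nat ->
  sudler beta (q - 1)
  = sudler beta (q - 1 - L)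
    * prod1 (fun r => Rabs (2 * sin (PI * (INR r * beta + - x)))) L.
Proof.
  intros Hq HL. replace (q - 1)%nat with ((q - 1 - L) + L)%nat at 1 by lia.
  rewrite !sudler_prod1, prod1_app. f_equal.
  rewrite <- (prod1_reindex (fun r => S L - r)%nat) by (intros; lia).
  apply big_ext. intros r Hr. rewrite !Rabs_mult. f_equal.
  replace (q - 1 - L + (S L - r))%nat with (q - r)%nat by lia.
  rewrite Rmult_assoc, minus_INR, Rmult_minus_distr_r, Hq by lia.
  replace (IZR p + x - INR r * beta) with (IZR p + - (INR r * beta + - x)) by ring.
  rewrite abs_sin_add_IZR, Ropp_mult_distr_r_reverse, sin_neg. apply Rabs_Ropp.
Qed.

Definition good_denominators (beta kappa : R) : Prop :=
  forall (eps : R) (N : nat), 0 < eps ->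
  exists (q : nat) (p : Z) (x : R),
    (N <= q)%nat /\ INR q * beta = IZR p + x /\ Rabs x < eps /\
    sudler beta q <= 24 / 25 /\ kappa * INR q <= sudler beta (q - 1).

(** Given [N], a good [q] is chosen with shift small enough for this [N]; passing to [q + N]
    multiplies the product by at most [24/25] up to a small error. *)
Lemma sudler_small (beta kappa : R) (t N0 : nat) :
  good_denominators beta kappa ->
  exists N, (N0 <= N)%nat /\ sudler beta N <= (49 / 50) ^ t.
Proof.
  intros Hgood. revert N0; induction t as [|t IH]; intros N0.
  - destruct (Hgood 1 N0 ltac:(lra)) as (q & p & x & HN & _ & _ & Hs & _).
    exists q. split; [easy|]. cbn. lra.
  - destruct (IH N0) as [N [HN Hs]].
    set (s := (49 / 50) ^ t) in *.
    assert (Hspos : 0 < s) by (apply pow_lt; lra).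
    (* The error [s / 48] is chosen because [(24/25) (49/48) = 49/50]. *)
    destruct (sudler_perturb beta (s / 48) N ltac:(lra)) as [d [Hd Hpert]].
    destruct (Hgood d N0 Hd) as (q & p & x & Hq & Heq & Hx & Hsq & _).
    exists (q + N)%nat. split; [lia|].
    rewrite (sudler_add _ _ _ _ _ Heq). specialize (Hpert x Hx).
    cbn [pow]. fold s.
    replace (49 / 50 * s) with (24 / 25 * (49 / 48 * s)) by field.
    apply Rmult_le_compat; [apply sudler_ge_0| |easy|lra].
    apply prod1_ge_0. intros; apply Rabs_pos.
Qed.

Lemma sudler_limits (beta kappa : R) :
  0 < kappa -> good_denominators beta kappa ->
  LimInf_seq (fun N : nat => sudler beta N) = Finite 0 /\
  LimSup_seq (fun N : nat => sudler beta N / INR N) = p_infty.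
Proof.
  intros Hk Hgood.
  assert (Hsmall : forall eps N0, 0 < eps -> exists N, (N0 <= N)%nat /\ sudler beta N < eps).
  { intros eps N0 Heps.
    destruct (pow_lt_1_zero (49 / 50) ltac:(rewrite Rabs_pos_eq; lra) eps Heps) as [t Ht].
    destruct (sudler_small beta kappa t N0 Hgood) as [N [HN Hs]].
    exists N. split; [easy|]. specialize (Ht t (Nat.le_refl t)).
    apply Rabs_lt_between in Ht. lra. }
  split.
  - apply is_LimInf_seq_unique. intros eps. assert (He := cond_pos eps). split.
    + intros N0. destruct (Hsmall eps N0 He) as [N [HN Hs]].
      exists N. split; [easy|]. lra.
    + exists O. intros N _. assert (H := sudler_ge_0 beta N). lra.
  - apply is_LimSup_seq_unique. intros M N0.
    set (M' := Rabs M + 1).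
    assert (HM : M < M' /\ 0 < M').
    { unfold M'. assert (H1 := Rle_abs M). assert (H2 := Rabs_pos M). lra. }
    (* Removing the last [L] factors from [P_(q-1)], whose product is at most [2 * eta], leaves at
       least [kappa q / (2 eta) = 2 M' q]. *)
    set (eta := kappa / (4 * M')).
    assert (Heta : 0 < eta) by (apply Rdiv_lt_0_compat; lra).
    destruct (Hsmall eta O Heta) as [L [_ HL]].
    destruct (sudler_perturb beta eta L Heta) as [d [Hd Hpert]].
    destruct (Hgood d (L + N0 + 2)%nat Hd) as (q & p & x & Hq & Heq & Hx & _ & Hlow).
    rewrite <- Rabs_Ropp in Hx. specialize (Hpert (- x) Hx).
    rewrite (sudler_reflect beta x p q L Heq ltac:(lia)) in Hlow.
    set (N := (q - 1 - L)%nat) in *.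
    exists N. split; [lia|].
    set (X := prod1 (fun r => Rabs (2 * sin (PI * (INR r * beta + - x)))) L) in *.
    assert (HN : 0 < INR N) by (apply lt_0_INR; lia).
    assert (HNq : INR N <= INR q) by (apply le_INR; lia).
    apply Rlt_le_trans with M'; [easy|]. apply Rle_div_r; [easy|].
    assert (HS := sudler_ge_0 beta N).
    assert (H1 : kappa * INR N <= sudler beta N * (2 * eta)).
    { apply Rle_trans with (kappa * INR q); [apply Rmult_le_compat_l; lra|].
      eapply Rle_trans; [exact Hlow|]. apply Rmult_le_compat_l; lra. }
    assert (E : kappa = 4 * M' * eta) by (unfold eta; field; lra).
    rewrite E in H1.
    apply Rmult_le_reg_r with (2 * eta); [lra|]. nra.
Qed.

Theorem theorem3 (h l : nat) (b a : nat -> nat) (beta : R) (k : nat)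
  (hl : (2 <= l)%nat)
  (hb : forall j : nat, (1 <= j <= h)%nat -> (0 < b j)%nat)
  (ha : forall j : nat, (1 <= j <= l)%nat -> (0 < a j)%nat)
  (hbeta : is_cfrac (ev_periodic h l b a) beta)
  (hk : (1 <= k <= l)%nat)
  (hmax : forall j : nat, (1 <= j <= l)%nat -> (a j <= a k)%nat)
  (hak : (23 <= a k)%nat) :
  LimInf_seq (fun N : nat => sudler beta N) = Finite 0 /\
  LimSup_seq (fun N : nat => sudler beta N / INR N) = p_infty.
Proof.
  set (c := ev_periodic h l b a) in *.
  assert (Hper : forall j, (h < j)%nat -> exists i, (1 <= i <= l)%nat /\ c j = a i).
  { intros j Hj. exists (S ((j - h - 1) mod l)).
    assert (H := Nat.mod_upper_bound (j - h - 1) l ltac:(lia)). split; [lia|].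
    unfold c, ev_periodic. now rewrite (proj2 (Nat.leb_gt j h) Hj). }
  assert (Hc : positive_seq c).
  { intros j Hj. destruct (Nat.le_gt_cases j h) as [H|H].
    - unfold c, ev_periodic. rewrite (proj2 (Nat.leb_le j h) H). apply hb; lia.
    - destruct (Hper j H) as [i [Hi ->]]. now apply ha. }
  assert (HA : forall j, (h < j)%nat -> (c j <= a k)%nat).
  { intros j Hj. destruct (Hper j Hj) as [i [Hi ->]]. now apply hmax. }
  destruct (bounded_prefix c h) as [B HB].
  apply (sudler_limits beta (exp (- (6 / 5)) / 2)).
  { assert (H := exp_pos (- (6 / 5))). lra. }
  intros eps N Heps.
  (* [n1] makes the approximation error smaller than [eps]; [n2] makes the preperiod's share of the
     weight at most [1/2]. *)
  destruct (INR_unbounded (/ eps)) as [n1 Hn1].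
  destruct (INR_unbounded (2 * (harmonic B * INR h))) as [n2 Hn2].
  (* Since [w] is congruent to [k] modulo [l], the quotient following the first [n], namely
     [c_(h+w)], is [a k]; among the first [n] quotients, [w - 1] come after the preperiod. *)
  set (w := (k + l * (n1 + n2 + N + 1))%nat).
  set (n := (w - 1 + h)%nat).
  assert (Hw : (n1 + n2 + N + 1 < w)%nat) by (unfold w; nia).
  assert (Hn : (n1 <= n /\ N <= n /\ 1 <= n)%nat) by (unfold n; lia).
  assert (Hcn : c (S n) = a k).
  { unfold c, ev_periodic.
    rewrite (proj2 (Nat.leb_gt (S n) h)) by (unfold n; lia).
    replace (S n - h - 1)%nat with (k - 1 + (n1 + n2 + N + 1) * l)%nat
      by (unfold n, w; lia).
    rewrite Nat.Div0.mod_add, Nat.mod_small by lia. f_equal. lia. }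
  assert (HW : denominator_weight (reversed c n) n <= harmonic (a k) * (7 / 2) + / 2).
  { eapply Rle_trans; [apply (denominator_weight_bound c h (w - 1) (a k) B); auto; lia|].
    apply Rplus_le_compat_l.
    assert (H1 : INR n2 <= INR (w - 1)) by (apply le_INR; lia).
    assert (H2 : 0 < INR (w - 1)) by (apply lt_0_INR; lia).
    apply Rle_div_l; [easy|]. lra. }
  destruct (sudler_at_denominator c beta n (a k) Hc hbeta) as [Hup Hlow];
    [lia|easy|lia|exact HW|].
  exists (cf_den c n), (Z.of_nat (cf_num c n)),
    (IZR ((-1) ^ Z.of_nat n) * cf_error c beta n).
  assert (HE := cf_error_pos c beta n Hc hbeta).
  assert (HE1 := cf_error_le c beta n Hc hbeta).
  assert (Hge := cf_den_ge c (S n) Hc).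
  repeat split; [| | |exact Hup|exact Hlow].
  - eapply Nat.le_trans; [|now apply cf_den_ge]. lia.
  - rewrite <- INR_IZR_INZ. apply cf_error_eq.
  - rewrite Rabs_mult, (Rabs_pos_eq (cf_error c beta n)) by lra.
    assert (Hs : Rabs (IZR ((-1) ^ Z.of_nat n)) = 1).
    { destruct (sign_cases n) as [H|H]; rewrite H; [apply Rabs_R1|].
      rewrite Rabs_left; lra. }
    rewrite Hs, Rmult_1_l.
    assert (Hq : / eps < INR (cf_den c (S n))).
    { eapply Rlt_le_trans; [exact Hn1|]. apply le_INR. lia. }
    assert (He : / eps * eps = 1) by (apply Rinv_l; lra).
    assert (0 < / eps) by now apply Rinv_0_lt_compat.
    apply Rmult_lt_reg_l with (INR (cf_den c (S n))); [lra|].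
    eapply Rle_lt_trans; [exact HE1|].
    rewrite <- He. apply Rmult_lt_compat_r; lra.
Qed.
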